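(* Let $\beta\in(0,1)$ and let the initial configurations $\mathfrak{A}(N)$, $N=1,2,\ldots$, satisfy Assumptions 1 and 2 of the context. Then there exists $N_0$ such that for all $N>N_0$ the equation $\mathsf{S}'(\mathsf{z})=0$ has a unique root $\mathsf{z}_c=\mathsf{z}_c(N)$ in the upper half plane (i.e. satisfying $\Im \mathsf{z}_c>0$). Moreover, there exists a compact set $\mathcal{Z}\subset\{\mathsf{z}\in\mathbb{C}:\Im\mathsf{z}>0\}$ such that $\mathsf{z}_c(N)\in\mathcal{Z}$ for all $N>N_0$. The set $\mathcal{Z}$ and the constant $N_0$ may depend on the constants in Assumptions 1 and 2, but not on the choice of $\mathfrak{A}(N)$.
   Context: Let $T=T(N)$ be positive integers with $T(N)\to+\infty$ and $T(N)\ll N$, where $A(N)\ll B(N)$ means $A(N)/B(N)\to0$ as $N\to\infty$. For each $N$ let $\mathfrak{A}(N)=(a_1(N)<\dots<a_N(N))$ be an $N$-tuple of integers; dependence on $N$ is often suppressed. Assumption 1. There exist scales $\mathsf{D}(N)\ll T(N)$ and $\mathsf{Q}(N)$ with $T(N)\ll\mathsf{Q}(N)\ll N$, and absolute constants $0<\rho_\bullet\le\rho^\bullet<1$, such that every segment of length $\mathsf{D}(N)$ inside $[-\mathsf{Q}(N),\mathsf{Q}(N)]$ contains at least $\rho_\bullet\mathsf{D}(N)$ and at most $\rho^\bullet\mathsf{D}(N)$ points of $\mathfrak{A}(N)$. Assumption 2. For all $\delta>0$, $R>0$ and all $N$ large enough, $\big|\sum_{i:\,RT(N)\le|a_i(N)|\le\delta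 N}\frac1{a_i(N)}\big|\le \mathsf{A}_{R,\delta}$, where $\mathsf{A}_{R,\delta}>0$ are absolute constants. (''Absolute constant'': not depending on $N$, $T(N)$ or $\mathfrak{A}(N)$.) The function $\mathsf{S}'$ is $$\mathsf{S}'(\mathsf{z})=\sum_{r=1}^N\frac{1}{T\mathsf{z}-a_r}-\mathrm{p.v.}\sum_{j\in\mathfrak{L}_T}\frac1{T\mathsf{z}-j}-\log(\beta^{-1}-1),$$ where $\mathfrak{L}_T=\{\ldots,-T-2,-T-1,-T\}\cup\{0,1,2,\ldots\}$ and $\mathrm{p.v.}\sum_{j\in\mathfrak{L}_T}=\lim_{M\to\infty}\sum_{j\in\mathfrak{L}_T,|j|<M}$. Throughout, $\beta$ and the scales $T,\mathsf{D},\mathsf{Q}$ are fixed data. *)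

(* Defs.v *)
From HB Require Import structures.
From mathcomp Require Import all_boot all_order all_algebra.
From mathcomp Require Import complex.
From mathcomp Require Import all_classical all_reals all_analysis.

Set Implicit Arguments.
Unset Strict Implicit.
Unset Printing Implicit Defensive.

Import Order.TTheory GRing.Theory Num.Theory.
Import numFieldNormedType.Exports.

Local Open Scope classical_set_scope.
Local Open Scope ring_scope.
Local Open Scope complex_scope.

(* A(N) << B(N) as N -> oo *)
Definition negligible_wrt (R : realType) (A B : nat -> R) : Prop :=
  (fun N => A N / B N) @ \oo --> (0 : R).

(* A configuration assigns to each N an N-tuple of integers
   a_1(N) < ... < a_N(N), indexed here by 0, ..., N-1. *)
Definition configuration := forall N : nat, 'I_N -> int.

Definition increasing_configuration (a : configuration) : Prop :=
  forall (N : nat) (i j : 'I_N), (i < j)%N -> a N i < a N j.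

(* Number of points of a_1(N), ..., a_N(N) in the closed segment [x, y]. *)
Definition points_in (R : realType) (a : configuration) (N : nat) (x y : R)
    : nat :=
  #|[set i : 'I_N | x <= (a N i)%:~R <= y]%SET|.

(* The part of Assumption 1 that involves the configuration; the conditions on
   the scales D, Q and the densities rlo, rup are those of [density_data]. *)
Definition assumption1 (R : realType) (D Q : nat -> R) (rlo rup : R)
    (a : configuration) : Prop :=
  forall (N : nat) (x : R), (0 < N)%N -> - Q N <= x -> x + D N <= Q N ->
    rlo * D N <= (points_in a N x (x + D N))%:R <= rup * D N.

Definition density_data (R : realType) (T : nat -> nat) (D Q : nat -> R)
    (rlo rup : R) : Prop :=
  [/\ forall N, (0 < N)%N -> 0 < D N /\ 0 < Q N,
      negligible_wrt D (fun N => (T N)%:R),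
      negligible_wrt (fun N => (T N)%:R) Q,
      negligible_wrt Q (fun N => N%:R)
    & 0 < rlo /\ rlo <= rup < 1].

(* [Nmin R0 delta] makes "all N large enough" explicit. It is one of the
   constants of the assumption, like the bounds [A R0 delta]: a threshold N_0
   that is uniform over configurations must be allowed to depend on it. *)
Definition assumption2 (R : realType) (T : nat -> nat) (A : R -> R -> R)
    (Nmin : R -> R -> nat) (a : configuration) : Prop :=
  forall (delta R0 : R), 0 < delta -> 0 < R0 ->
  forall N : nat, (0 < N)%N -> (Nmin R0 delta <= N)%N ->
    `| \sum_(i < N | R0 * (T N)%:R <= `|(a N i)%:~R| <= delta * N%:R)
         ((a N i)%:~R)^-1 | <= A R0 delta.

(* {..., -t-2, -t-1, -t} U {0, 1, 2, ...} *)
Definition Lset (t : nat) : set int := [set j : int | j <= - t%:Z \/ 0 <= j].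

(* R[i]^o is R[i] with the topology given by its modulus. *)
Definition pv_sum (R : realType) (t : nat) (f : int -> R[i]) : R[i] :=
  limn (fun M : nat =>
    (\sum_(j \in Lset t `&` [set j : int | (`|j| < M%:Z)%R]) f j) : R[i]^o).

Definition S' (R : realType) (beta : R) (T : nat -> nat) (a : configuration)
    (N : nat) (z : R[i]) : R[i] :=
  \sum_(r < N) ((T N)%:R * z - (a N r)%:~R)^-1
  - pv_sum (T N) (fun j => ((T N)%:R * z - j%:~R)^-1)
  - (ln (beta^-1 - 1))%:C.

Definition upper_half_plane (R : realType) : set R[i] :=
  [set z | 0 < complex.Im z].

Definition upper_root (R : realType) (beta : R) (T : nat -> nat)
    (a : configuration) (N : nat) (z : R[i]) : Prop :=
  upper_half_plane z /\ S' beta T a N z = 0.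

(* Main.v *)
Require Import Defs.
From mathcomp Require Import all_boot all_order all_algebra.
From mathcomp Require Import complex.
From mathcomp Require Import all_classical all_reals all_analysis.
From mathcomp Require Import zify ring lra.
Import Order.TTheory GRing.Theory Num.Theory.
Import numFieldNormedType.Exports.
Local Open Scope classical_set_scope.
Local Open Scope ring_scope.
Local Open Scope complex_scope.

(* Put w = T z, let j run over the integers, and write c_j for the coefficients
   chi_a - chi_L of the poles 1 / (w - j) of S': nonnegative for -T < j < 0,
   nonpositive for the other j, and -1 for |j| large.

   Uniqueness. If w1 <> w2 are two roots in the upper half plane, then their
   conjugates are roots too, and a linear combination of the four equations
   removes the constant and gives sum_j c_j h(j) / (|w1 - j|^2 |w2 - j|^2) = 0
   with h(j) = j (j + T). But c_j h(j) <= 0 for every j, strictly for j large.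

   Existence. Use the coordinates w = - T / (1 + r e^{i phi}), in which
   |w + T| / |w| = r. For fixed r, Im S' is a positive factor times
   - sum_j c_j / B_j, where B_j = (T + j)^2 + r^2 j^2 + 2 r j (j + T) cos phi,
   so the sum increases with cos phi, again because c_j j (j + T) <= 0. Counting
   points and holes of the configuration at distance Im w from w shows that it
   changes sign. Hence Im S' vanishes along a continuous curve phi = phi(r). On
   this curve Re S' is positive for r large, where w is close to 0 and the points
   in (-T, 0) at dyadic distances from 0 contribute a logarithm, and negative for
   r small, by the reflection j -> - T - j. The intermediate value theorem gives a
   root. Assumption 2 is needed only to bound the contribution of |j| >= 4 T to
   Re S'. *)

Set Implicit Arguments.
Unset Strict Implicit.

(** * Sums over finite sets of integers *)

(** The p.v. sums converge only along the symmetric ranges, which the reflection [j -> - T - j] does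
    not preserve. So the estimates are proved for arbitrary duplicate-free lists of integers that
    contain, or stay inside, prescribed intervals; limits are taken afterwards, and the terms
    [|j| >= 4 T] of Re S' are never reflected.

    Uniformity over configurations comes from the order in which the constants are fixed: the
    density margin [g]; the smallest sine [s1 = g / 32], for which Im S' has opposite signs at the
    two ends of every arc r = const; the ratio [la = 3 / s1] that bounds |Re w| / Im w where w is
    close to 0; the number [n] of dyadic scales, whose contribution [n g / 10] has to beat the
    constant of S', the bound [A 4 1] and all fixed errors; [K], so that these [n] scales fit
    between w and T when r = K; and the height [y0 T], which is a lower bound for Im w on the region
    1/K <= r <= K, sin phi >= s1. Only then is N taken large, so that windows of length [y0 T] are
    long compared with [D] and remain inside [-Q, Q]. Divided by T, the region lies in a fixed
    compact box. *)

(** The truncation of [pv_sum], as a list that can be filtered, compared and reflected. Since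
    [Negz n] is [-(n+1)], the negative half has [M.-1] entries. *)
Definition sym_range (M : nat) : seq int :=
  [seq Posz n | n <- iota 0 M] ++ [seq Negz n | n <- iota 0 M.-1].

Lemma mem_sym_range (M : nat) (j : int) : (j \in sym_range M) = (`|j| < M%:Z).
Proof.
rewrite mem_cat; case: j => n.
  rewrite mem_map ?mem_iota; last by move=> x y [].
  rewrite add0n leq0n /=.
  case: mapP => [[x _ //]|_]; rewrite orbF; lia.
case: mapP => [[x _ //]|_] /=.
rewrite mem_map ?mem_iota; last by move=> x y [].
lia.
Qed.

Lemma sym_range_uniq (M : nat) : uniq (sym_range M).
Proof.
rewrite cat_uniq !map_inj_uniq ?iota_uniq /=; try by move=> x y [].
by rewrite andbT; apply/hasPn => _ /mapP[x _ ->]; apply/negP => /mapP[].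
Qed.

Lemma sum_uniq_eq (V : nmodType) (s1 s2 : seq int) (P : pred int) (f : int -> V) :
  uniq s1 -> uniq s2 -> (forall j, P j -> (j \in s1) = (j \in s2)) ->
  \sum_(j <- s1 | P j) f j = \sum_(j <- s2 | P j) f j.
Proof.
move=> u1 u2 s12; rewrite -big_filter -[RHS]big_filter; apply: perm_big.
apply: uniq_perm; rewrite ?filter_uniq // => j; rewrite !mem_filter.
by case Pj: (P j) => //=; apply: s12.
Qed.

Lemma sum_uniq_le (R : realType) (I : eqType) (s1 s2 : seq I) (P : pred I)
    (f : I -> R) :
  uniq s1 -> uniq s2 -> (forall j, P j -> j \in s1 -> j \in s2) ->
  (forall j, P j -> 0 <= f j) ->
  \sum_(j <- s1 | P j) f j <= \sum_(j <- s2 | P j) f j.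
Proof.
move=> u1 u2 s12 f0.
rewrite [leRHS](bigID (mem s1)) /=.
have -> : \sum_(j <- s1 | P j) f j = \sum_(j <- s2 | P j && (j \in s1)) f j.
  rewrite -big_filter -[RHS]big_filter; apply: perm_big.
  apply: uniq_perm; rewrite ?filter_uniq // => j; rewrite !mem_filter.
  case Pj: (P j) => //=; case js1: (j \in s1) => //=.
  by rewrite s12.
by rewrite lerDl sumr_ge0 // => j /andP[Pj _]; exact: f0.
Qed.

Lemma sum_tele_le (R : realType) (s : seq nat) (k : nat) (f F : nat -> R) :
  uniq s -> all (fun n => (n < k)%N) s ->
  (forall n, (n < k)%N -> 0 <= f n <= F n.+1 - F n) ->
  \sum_(n <- s) f n <= F k - F 0.
Proof.
move=> us /allP sk fF.
have le1 : \sum_(n <- s | (n < k)%N) f n <= \sum_(n <- iota 0 k | (n < k)%N) f n.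
  apply: sum_uniq_le; rewrite ?iota_uniq //.
    by move=> j jk _; rewrite mem_iota.
  by move=> j /fF/andP[].
rewrite (_ : \sum_(n <- s) f n = \sum_(n <- s | (n < k)%N) f n); last first.
  rewrite big_seq [RHS]big_seq_cond; apply: eq_bigl => j.
  by case js: (j \in s) => //=; rewrite sk.
apply: (le_trans le1).
have -> : iota 0 k = index_iota 0 k by rewrite /index_iota subn0.
rewrite -(telescope_sumr F (leq0n k)) big_mkcond /=.
apply: ler_sum_nat => n /andP[_ nk]; rewrite nk.
by case/andP: (fF n nk).
Qed.

(** A discrete integral test, used for the tail bounds: [F] is an antiderivative for the majorant
    [g], and [idx] numbers the integers in [P] without repetition. *)
Lemma sum_int_tele_le (R : realType) (s : seq int) (P : pred int)
    (idx : int -> nat) (f : int -> R) (g F : nat -> R) (B : R) :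
  uniq s -> {in P &, injective idx} ->
  (forall j, P j -> f j <= g (idx j)) ->
  (forall n, 0 <= g n <= F n.+1 - F n) ->
  (forall n, F n <= B) ->
  \sum_(j <- s | P j) f j <= B - F 0.
Proof.
move=> us idxI fg gF FB.
apply: (@le_trans _ _ (\sum_(j <- s | P j) g (idx j))); first exact: ler_sum.
rewrite -big_filter -(big_map idx xpredT).
set t := map _ _.
have ut : uniq t.
  rewrite map_inj_in_uniq ?filter_uniq // => x y.
  by rewrite !mem_filter => /andP[Px _] /andP[Py _]; exact: idxI.
have [k tk] : exists k, all (fun n => (n < k)%N) t.
  exists (\max_(n <- t) n).+1; apply/allP => n nt.
  by rewrite ltnS (big_rem n) //= leq_maxl.
apply: (le_trans (sum_tele_le ut tk _)) => //.
by rewrite lerD2r.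
Qed.

Lemma sum_count_le (R : realType) (s : seq int) (x y : R) : uniq s -> x <= y + 1 ->
  \sum_(j <- s | x <= j%:~R <= y) 1 <= y - x + 1 :> R.
Proof.
move=> us xy.
set lo := Num.ceil x; set hi := Num.floor y.
have lo1 : x <= lo%:~R by exact: ceil_ge.
have hi1 : hi%:~R <= y by exact: floor_le.
have [lohi|hilo] := ltP hi lo.
  rewrite big1_seq; first by lra.
  move=> j /andP[/andP[xj jy] _].
  have : (lo <= j) by rewrite ceil_le_int.
  have : (j <= hi) by rewrite floor_ge_int.
  by lia.
set t := [seq lo + Posz n | n <- iota 0 (absz (hi - lo + 1))].
have : \sum_(j <- s | x <= j%:~R <= y) 1 <= \sum_(j <- t | x <= j%:~R <= y) (1 : R).
  apply: sum_uniq_le => //.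
    by rewrite map_inj_uniq ?iota_uniq // => a b /addrI[].
  move=> j /andP[xj jy] _.
  have jlo : (lo <= j) by rewrite ceil_le_int.
  have jhi : (j <= hi) by rewrite floor_ge_int.
  apply/mapP; exists (absz (j - lo)); first by rewrite mem_iota; lia.
  by lia.
move=> /le_trans; apply.
apply: (@le_trans _ _ (\sum_(j <- t) (1 : R))).
  by rewrite big_mkcond; apply: ler_sum => j _; case: ifP.
rewrite big_const_seq count_predT iter_addr addr0 size_map size_iota.
have -> : 1 *+ absz (hi - lo + 1) = hi%:~R - lo%:~R + 1 :> R.
  by rewrite natr_absz ger0_norm ?rmorphD ?rmorphN //=; lia.
by lra.
Qed.

Lemma sum_count_ge (R : realType) (s : seq int) (x y : R) : uniq s ->
  (forall j : int, x <= j%:~R <= y -> j \in s) ->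
  y - x - 1 <= \sum_(j <- s | x <= j%:~R <= y) 1 :> R.
Proof.
move=> us sxy.
set lo := Num.ceil x; set hi := Num.floor y.
have lo1 : lo%:~R < x + 1.
  have : lo - 1 < lo by lia.
  by rewrite ltNge ceil_le_int -ltNge rmorphB /=; lra.
have hi1 : y < hi%:~R + 1 by have := floor_itv y; rewrite -/hi rmorphD /=; lra.
have [lohi|hilo] := ltP hi lo.
  have : 0 <= \sum_(j <- s | x <= j%:~R <= y) 1 :> R by rewrite sumr_ge0.
  have : hi%:~R + 1 <= lo%:~R :> R by rewrite -(intrD _ _ 1) ler_int; lia.
  by lra.
set t := [seq lo + Posz n | n <- iota 0 (absz (hi - lo + 1))].
have tP j : j \in t -> x <= (j%:~R : R) <= y.
  move=> /mapP[n]; rewrite mem_iota => nb ->.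
  by rewrite -ceil_le_int -floor_ge_int -/lo -/hi; lia.
have : \sum_(j <- t | x <= j%:~R <= y) 1 <= \sum_(j <- s | x <= j%:~R <= y) (1 : R).
  apply: sum_uniq_le => //.
    by rewrite map_inj_uniq ?iota_uniq // => a b /addrI[].
  by move=> j /sxy.
apply: le_trans.
rewrite big_seq_cond (eq_bigl (mem t)); last first.
  by move=> j /=; case jt: (j \in t) => //=; rewrite tP.
rewrite -big_seq.
rewrite big_const_seq count_predT iter_addr addr0 size_map size_iota.
have -> : 1 *+ absz (hi - lo + 1) = hi%:~R - lo%:~R + 1 :> R.
  by rewrite natr_absz ger0_norm ?rmorphD ?rmorphN //=; lia.
by lra.
Qed.

Lemma sum_int_sign_le (R : realType) (s : seq int) (f : int -> R) (g F : nat -> R)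
    (B : R) : uniq s -> (forall j, f j <= g `|j|%N) ->
  (forall n, 0 <= g n <= F n.+1 - F n) -> (forall n, F n <= B) ->
  \sum_(j <- s) f j <= (B - F 0) *+ 2.
Proof.
move=> us fg gF FB; rewrite (bigID (fun j : int => 0 <= j)) /= mulr2n.
by apply: lerD; apply: (sum_int_tele_le (idx := absz) (g := g)) => // x y;
  rewrite -!topredE /=; lia.
Qed.

Definition inv1sq (R : realType) (j : int) : R := (1 + j%:~R ^+ 2)^-1.

Lemma inv1sq_gt0 (R : realType) (j : int) : 0 < inv1sq R j.
Proof. by rewrite invr_gt0 ltr_pwDl ?sqr_ge0. Qed.

Lemma sum_inv1sq_le (R : realType) (s : seq int) : uniq s ->
  \sum_(j <- s) inv1sq R j <= 8.
Proof.
move=> us.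
(* The increments of [-4/(n+1)] are [4/((n+1)(n+2))], and [(n+1)(n+2) <= 4(1+n^2)]. Each sign of [j]
   contributes 4. *)
apply: le_trans (@sum_int_sign_le R s (inv1sq R) (fun n => (1 + n%:R ^+ 2)^-1)
  (fun n => - (4 / (n%:R + 1))) 0 us _ _ _) _; last first.
- by rewrite /= mulr0n !add0r opprK divr1; lra.
- by move=> n; rewrite oppr_le0 divr_ge0.
- move=> n; have n0 : 0 <= n%:R :> R by [].
  rewrite invr_ge0 addr_ge0 ?sqr_ge0 //= -natr1.
  rewrite [leRHS](_ : _ = 4 / ((n%:R + 1) * (n%:R + 2))); last first.
    by field; apply/andP; split; lra.
  rewrite ler_pdivlMr; last by nra.
  rewrite mulrC ler_pdivrMr; last by nra.
  have := sqr_ge0 (n%:R - 1 / 2 : R); nra.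
- move=> j; rewrite /inv1sq; case: j => n //=.
  by rewrite NegzE /= rmorphN sqrrN.
Qed.

(** * Limits along symmetric ranges *)

Definition sym_lim (R : realType) (f : int -> R) : R :=
  limn (fun M => \sum_(j <- sym_range M) f j).

Definition sym_cvg (R : realType) (f : int -> R) : Prop :=
  cvgn (fun M => \sum_(j <- sym_range M) f j).

Lemma sym_range_mono (M M' : nat) : (M <= M')%N -> {subset sym_range M <= sym_range M'}.
Proof. by move=> MM' j; rewrite !mem_sym_range; lia. Qed.

Lemma sym_cvg_ge0 (R : realType) (f : int -> R) (C : R) :
  (forall j, 0 <= f j <= C * inv1sq R j) -> sym_cvg f.
Proof.
move=> fC; apply: nondecreasing_is_cvgn.
  move=> M M' MM'; apply: (@sum_uniq_le R) => //; rewrite ?sym_range_uniq //.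
    by move=> j _; exact: sym_range_mono.
  by move=> j _; case/andP: (fC j).
exists (C * 8) => _ [M _ <-].
apply: (@le_trans _ _ (\sum_(j <- sym_range M) C * inv1sq R j)).
  by apply: ler_sum => j _; case/andP: (fC j).
rewrite -mulr_sumr ler_wpM2l ?sum_inv1sq_le ?sym_range_uniq //.
by have /andP[h1 /(le_trans h1)] := fC 0; rewrite pmulr_lge0 ?inv1sq_gt0.
Qed.

(** Adding [C * inv1sq] makes the terms nonnegative, so monotone convergence applies to both parts
    of the difference. *)
Lemma sym_cvg_dom (R : realType) (f : int -> R) (C : R) :
  (forall j, `|f j| <= C * inv1sq R j) -> sym_cvg f.
Proof.
move=> fC.
have C0 : 0 <= C.
  by have := le_trans (normr_ge0 _) (fC 0); rewrite pmulr_lge0 ?inv1sq_gt0.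
have c1 : sym_cvg (fun j => f j + C * inv1sq R j).
  apply: (@sym_cvg_ge0 _ _ (2 * C)) => j.
  by move: (fC j); rewrite ler_norml -mulrA; lra.
have c2 : sym_cvg (fun j => C * inv1sq R j).
  apply: (@sym_cvg_ge0 _ _ C) => j.
  by rewrite lexx andbT mulr_ge0 // ltW // inv1sq_gt0.
rewrite /sym_cvg (_ : (fun M => _) = (fun M => \sum_(j <- sym_range M)
  (f j + C * inv1sq R j)) \- (fun M => \sum_(j <- sym_range M) C * inv1sq R j)).
  exact: is_cvgB c1 c2.
apply/funext => M /=; rewrite -sumrB.
by apply: eq_bigr => j _; rewrite addrK.
Qed.

Lemma sym_lim_ge (R : realType) (f : int -> R) (x : R) : sym_cvg f ->
  (exists M0 : nat, forall M, (M0 <= M)%N -> x <= \sum_(j <- sym_range M) f j) ->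
  x <= sym_lim f.
Proof.
by move=> cf [M0 fM]; apply: limr_ge => //; exists M0 => // M /=; exact: fM.
Qed.

Lemma sym_lim_le (R : realType) (f : int -> R) (x : R) : sym_cvg f ->
  (exists M0 : nat, forall M, (M0 <= M)%N -> \sum_(j <- sym_range M) f j <= x) ->
  sym_lim f <= x.
Proof.
by move=> cf [M0 fM]; apply: limr_le => //; exists M0 => // M /=; exact: fM.
Qed.

(** Oddness, with the convention [0^-1 = 0] for the middle term. Thus [1/j] may be subtracted inside
    any symmetric sum, which turns a conditionally convergent sum into an absolutely convergent
    one. *)
Lemma sum_sym_inv (R : realType) (M : nat) :
  \sum_(j <- sym_range M) (j%:~R)^-1 = 0 :> R.
Proof.
rewrite big_cat /= !big_map; case: M => [|M]; first by rewrite !big_nil addr0.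
rewrite /= big_cons /= invr0 add0r.
have -> : iota 1 M = [seq n.+1 | n <- iota 0 M].
  by rewrite (iotaDl 1 0).
rewrite big_map -big_split big1 // => n _ /=.
by rewrite NegzE rmorphN invrN /= subrr.
Qed.

(** * The kernels and their sums over the poles *)

(* [kre] and [- kim] are the real and imaginary parts of [1 / (u + iv - j)]. *)
Definition sqdist (R : realType) (u v : R) (j : int) : R :=
  (u - j%:~R) ^+ 2 + v ^+ 2.
Definition kre (R : realType) (u v : R) (j : int) : R :=
  (u - j%:~R) / sqdist u v j.
Definition kim (R : realType) (u v : R) (j : int) : R := v / sqdist u v j.

(* The coefficients [chi_a - chi_L] of the simple poles of S': nonnegative
   inside (-T, 0), nonpositive on L, and equal to [-1] far away. *)
Definition signed_weight (R : realType) (T : nat) (c : int -> R) : Prop :=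
  [/\ forall j : int, (- T%:Z < j < 0) -> 0 <= c j <= 1,
      forall j : int, ~~ (- T%:Z < j < 0) -> -1 <= c j <= 0
    & exists J : nat, forall j : int, J%:Z <= `|j| -> c j = -1].

Lemma signed_weight_norm (R : realType) (T : nat) (c : int -> R) (j : int) :
  signed_weight T c -> `|c j| <= 1.
Proof.
move=> [ci co _]; rewrite ler_norml.
by case: (boolP (- T%:Z < j < 0)) => [/ci|/co]; lra.
Qed.

Lemma sqdist_gt0 (R : realType) (u v : R) (j : int) : 0 < v -> 0 < sqdist u v j.
Proof. by move=> v0; rewrite /sqdist ltr_wpDl ?sqr_ge0 ?exprn_gt0. Qed.

(** Makes [1 + j^2 <= sqdist_const U v0 * sqdist u v j] for [|u| <= U] and [v >= v0]: use
    [j^2 <= 2 (u-j)^2 + 2 u^2] and absorb [2 U^2 + 1] into a multiple of [v^2]. *)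
Definition sqdist_const (R : realType) (U v : R) : R := 2 + (2 * U ^+ 2 + 1) / v ^+ 2.

Lemma sqdist_const_gt0 (R : realType) (U v : R) : 0 < sqdist_const U v.
Proof.
rewrite /sqdist_const; have : 0 <= (2 * U ^+ 2 + 1) / v ^+ 2.
  by rewrite divr_ge0 ?sqr_ge0 //; have := sqr_ge0 U; lra.
lra.
Qed.

Lemma sqdist_inv_le (R : realType) (U v0 u v : R) (j : int) :
  `|u| <= U -> 0 < v0 -> v0 <= v ->
  (sqdist u v j)^-1 <= sqdist_const U v0 * inv1sq R j.
Proof.
move=> uU v0_gt0 v0v; have v_gt0 : 0 < v by exact: lt_le_trans v0v.
rewrite /inv1sq -div1r ler_pdivrMr ?sqdist_gt0 // mulrAC ler_pdivlMr; last first.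
  by rewrite ltr_pwDl ?sqr_ge0.
rewrite mul1r /sqdist_const /sqdist.
set x : R := j%:~R.
have u2 : u ^+ 2 <= U ^+ 2.
  by rewrite -[u ^+ 2]real_normK ?num_real // lerXn2r ?nnegrE // (le_trans _ uU).
have h1 : 2 * U ^+ 2 + 1 <= (2 * U ^+ 2 + 1) / v0 ^+ 2 * v ^+ 2.
  rewrite mulrAC ler_pdivlMr ?exprn_gt0 // ler_wpM2l //.
    by have := sqr_ge0 U; lra.
  by rewrite lerXn2r ?nnegrE // ltW.
have h2 : 0 <= (2 * U ^+ 2 + 1) / v0 ^+ 2.
  by rewrite divr_ge0 ?sqr_ge0 //; have := sqr_ge0 U; lra.
have h3 := mulr_ge0 h2 (sqr_ge0 (u - x)).
have h4 := sqr_ge0 (2 * u - x); have h5 := sqr_ge0 v.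
have h6 : x ^+ 2 <= 2 * (u - x) ^+ 2 + 2 * u ^+ 2 by have := sqr_ge0 (2 * u - x); nra.
rewrite mulrDl [X in _ <= _ + X]mulrDr.
lra.
Qed.

Lemma kre_invD (R : realType) (u v : R) (j : int) : 0 < v -> j != 0 ->
  kre u v j + (j%:~R)^-1 = (u ^+ 2 + v ^+ 2 - u * j%:~R) / (j%:~R * sqdist u v j).
Proof.
move=> v0 j0; have := sqdist_gt0 u j v0; rewrite /kre /sqdist => q0.
by field; rewrite intr_eq0 j0 /= gt_eqF.
Qed.

Lemma kre_norm_le (R : realType) (u v : R) (j : int) : 0 < v ->
  `|kre u v j| <= 1 + (v ^+ 2)^-1.
Proof.
move=> v0; have q0 := sqdist_gt0 u j v0.
rewrite /kre normrM normfV [`|sqdist _ _ _|]gtr0_norm // ler_pdivrMr //.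
rewrite mulrDl mul1r; have v2 : 0 < v ^+ 2 by rewrite exprn_gt0.
have : 1 <= (v ^+ 2)^-1 * sqdist u v j.
  rewrite mulrC ler_pdivlMr // mul1r /sqdist; have := sqr_ge0 (u - j%:~R); lra.
have : `|u - j%:~R| <= 1 + (u - j%:~R) ^+ 2.
  rewrite ler_norml; have := sqr_ge0 (u - j%:~R - 1); have := sqr_ge0 (u - j%:~R + 1).
  by have := sqr_ge0 (u - j%:~R); nra.
rewrite /sqdist; lra.
Qed.

Lemma sym_cvg_kim (R : realType) (T : nat) (c : int -> R) (u v : R) :
  signed_weight T c -> 0 < v -> sym_cvg (fun j => c j * kim u v j).
Proof.
move=> cw v0; apply: (@sym_cvg_dom _ _ (v * sqdist_const `|u| v)) => j.
rewrite normrM /kim -[leRHS]mul1r; apply: ler_pM => //.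
  exact: signed_weight_norm cw.
rewrite ger0_norm ?divr_ge0 ?(ltW v0) ?(ltW (sqdist_gt0 _ _ v0)) //.
by rewrite -mulrA ler_pM2l // sqdist_inv_le.
Qed.

(** The terms are only of order [1/j]. Where [c j = -1], subtracting [1/j] leaves
    [-(kre u v j + 1/j) = O(1/j^2)]; this gives [C1], and [C2] covers the finitely many other
    [j]. *)
Lemma sym_cvg_kre (R : realType) (T : nat) (c : int -> R) (u v : R) :
  signed_weight T c -> 0 < v -> sym_cvg (fun j => c j * kre u v j).
Proof.
move=> cw v0; have [_ _ [J cJ]] := cw.
have v2 : 0 < v ^+ 2 by rewrite exprn_gt0.
pose f j := c j * kre u v j - (j%:~R)^-1.
rewrite /sym_cvg.
have -> : (fun M => \sum_(j <- sym_range M) c j * kre u v j) =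
          (fun M => \sum_(j <- sym_range M) f j).
  by apply/funext => M; rewrite sumrB sum_sym_inv subr0.
set C1 := (u ^+ 2 + v ^+ 2 + `|u|) * sqdist_const `|u| v.
set C2 := (2 + (v ^+ 2)^-1) * (1 + J.+1%:R ^+ 2).
have C1_ge0 : 0 <= C1.
  by rewrite mulr_ge0 ?(ltW (sqdist_const_gt0 _ _)) // !addr_ge0 ?sqr_ge0.
have C2_ge0 : 0 <= C2.
  by rewrite mulr_ge0 // addr_ge0 ?sqr_ge0 // invr_ge0 ltW.
apply: (@sym_cvg_dom _ _ (C1 + C2)) => j.
have i0 := inv1sq_gt0 R j.
have [Jj|jJ] := leP J.+1%:Z `|j|.
  apply: (@le_trans _ _ (C1 * inv1sq R j)); last by rewrite ler_pM2r // lerDl.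
  have j0 : j != 0 by lia.
  rewrite /f cJ; last by lia.
  rewrite mulN1r -opprD normrN kre_invD // normrM normfV normrM.
  rewrite [`|sqdist _ _ _|]gtr0_norm ?sqdist_gt0 // invfM mulrA /C1 -[leRHS]mulrA.
  apply: ler_pM.
  - by rewrite mulr_ge0.
  - by rewrite invr_ge0 ltW // sqdist_gt0.
  - have j1 : 1 <= `|j%:~R| :> R.
      by rewrite -intr_norm -[1]/(1%:~R) ler_int; lia.
    rewrite ler_pdivrMr; last exact: lt_le_trans j1.
    apply: (le_trans (ler_normB _ _)); rewrite [`|u * _|]normrM.
    have m0 : 0 <= u ^+ 2 + v ^+ 2 by rewrite addr_ge0 ?sqr_ge0.
    rewrite (ger0_norm m0).
    by rewrite [leRHS]mulrDl lerD2r ler_peMr ?addr_ge0 ?sqr_ge0.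
  - exact: sqdist_inv_le.
apply: (@le_trans _ _ (C2 * inv1sq R j)); last by rewrite ler_pM2r // lerDr.
rewrite /C2 -mulrA -[leLHS]mulr1; apply: ler_pM => //.
  apply: (le_trans (ler_normB _ _)); rewrite normrM.
  have := kre_norm_le u j v0; have := signed_weight_norm j cw.
  have : `|(j%:~R : R)^-1| <= 1.
    rewrite normfV; have [->|j0] := eqVneq j 0; first by rewrite normr0 invr0.
    have j1 : 1 <= `|j%:~R| :> R.
      by rewrite -intr_norm -[1]/(1%:~R) ler_int; lia.
    by rewrite invf_le1 // (lt_le_trans _ j1).
  move=> h1 h2 h3.
  have := ler_pM (normr_ge0 _) (normr_ge0 _) h2 h3; lra.
rewrite /inv1sq ler_pdivlMr ?mul1r ?lerD2l; last by rewrite ltr_pwDl ?sqr_ge0.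
rewrite -[leLHS]real_normK ?num_real // lerXn2r ?nnegrE //.
by rewrite -intr_norm -[J.+1%:R]/(J.+1%:Z%:~R) ler_int ltW.
Qed.

(** With [w = u + iv] and [w0 = u0 + iv0], the difference of [1/(w-j)] and [1/(w0-j)] is
    [-(w-w0) / ((w-j)(w0-j))]. The quantities in [h1] and [h2] are the real and imaginary parts of
    [(w-j)(w0-j)], bounded by [|w-j|^2 + |w0-j|^2]. *)
Lemma kernel_lipschitz (R : realType) (u v u0 v0 : R) (j : int) :
  0 < v -> 0 < v0 ->
  let L := (`|u - u0| + `|v - v0|) * ((sqdist u v j)^-1 + (sqdist u0 v0 j)^-1) in
  `|kre u v j - kre u0 v0 j| <= L /\ `|kim u v j - kim u0 v0 j| <= L.
Proof.
move=> v_gt0 v0_gt0 L.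
have q_gt0 := sqdist_gt0 u j v_gt0; have q0_gt0 := sqdist_gt0 u0 j v0_gt0.
pose a := u - j%:~R; pose a0 := u0 - j%:~R.
have qq0 : 0 < sqdist u v j * sqdist u0 v0 j by rewrite mulr_gt0.
have LE : L = (`|u - u0| + `|v - v0|) * (sqdist u v j + sqdist u0 v0 j) /
    (sqdist u v j * sqdist u0 v0 j).
  by rewrite /L; field; rewrite !gt_eqF.
have bnd x y : `|x| <= sqdist u v j + sqdist u0 v0 j ->
   `|y| <= sqdist u v j + sqdist u0 v0 j ->
   `|((u - u0) * x + (v - v0) * y) / (sqdist u v j * sqdist u0 v0 j)| <= L.
  move=> hx hy; rewrite LE normrM normfV [`|_ * sqdist _ _ _|]gtr0_norm //.
  rewrite ler_pM2r ?invr_gt0 //; apply: (le_trans (ler_normD _ _)).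
  by rewrite !normrM mulrDl lerD // ler_wpM2l.
have h1 : `|a * a0 - v * v0| <= sqdist u v j + sqdist u0 v0 j.
  rewrite ler_norml /sqdist -/a -/a0.
  have := sqr_ge0 (a - a0); have := sqr_ge0 (a + a0).
  have := sqr_ge0 (v - v0); have := sqr_ge0 (v + v0).
  have := sqr_ge0 v; have := sqr_ge0 v0; have := sqr_ge0 a; have := sqr_ge0 a0; nra.
have h2 : `|a * v0 + a0 * v| <= sqdist u v j + sqdist u0 v0 j.
  rewrite ler_norml /sqdist -/a -/a0.
  have := sqr_ge0 (a - v0); have := sqr_ge0 (a + v0).
  have := sqr_ge0 (a0 - v); have := sqr_ge0 (a0 + v).
  have := sqr_ge0 v; have := sqr_ge0 v0; have := sqr_ge0 a; have := sqr_ge0 a0; nra.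
split.
  have -> : kre u v j - kre u0 v0 j = ((u - u0) * - (a * a0 - v * v0) +
      (v - v0) * - (a * v0 + a0 * v)) / (sqdist u v j * sqdist u0 v0 j).
    move: q_gt0 q0_gt0; rewrite /kre /sqdist /a /a0 => q1 q2.
    by field; rewrite !gt_eqF.
  by apply: bnd; rewrite normrN.
have -> : kim u v j - kim u0 v0 j = ((u - u0) * - (a * v0 + a0 * v) +
    (v - v0) * (a * a0 - v * v0)) / (sqdist u v j * sqdist u0 v0 j).
  move: q_gt0 q0_gt0; rewrite /kim /sqdist /a /a0 => q1 q2.
  by field; rewrite !gt_eqF.
by apply: bnd; rewrite ?normrN.
Qed.

Lemma sym_lim_lipschitz (R : realType) (f g : int -> R) (c : R) :
  sym_cvg f -> sym_cvg g -> (forall j, `|f j - g j| <= c * inv1sq R j) ->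
  `|sym_lim f - sym_lim g| <= c * 8.
Proof.
move=> cf cg fg; rewrite /sym_lim -limB // -lim_norm; last exact: is_cvgB.
apply: limr_le; first by apply: is_cvg_norm; exact: is_cvgB.
apply: nearW => M.
rewrite -[leLHS]/(`|\sum_(j <- sym_range M) f j - \sum_(j <- sym_range M) g j|).
rewrite -sumrB; apply: (le_trans (ler_norm_sum _ _ _)).
apply: (@le_trans _ _ (\sum_(j <- sym_range M) c * inv1sq R j)).
  exact: ler_sum.
rewrite -mulr_sumr ler_wpM2l ?sum_inv1sq_le ?sym_range_uniq //.
by have := le_trans (normr_ge0 _) (fg 0); rewrite pmulr_lge0 ?inv1sq_gt0.
Qed.

(** The Lipschitz bound is asked only for [v >= v0 / 2], because the kernels degenerate at the real
    axis. *)
Lemma cvg_of_lipschitz2 (R : realType) (f : R -> R -> R) (u0 v0 C : R) : 0 < v0 ->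
  (forall u v, `|u - u0| <= 1 -> v0 / 2 <= v ->
     `|f u v - f u0 v0| <= C * (`|u - u0| + `|v - v0|)) ->
  (fun p : R * R => f p.1 p.2) @ (u0, v0) --> f u0 v0.
Proof.
move=> v0_gt0 fC; apply/cvgrPdist_le => e e0.
pose D := Num.max C 1.
have D1 : 1 <= D by rewrite le_max lexx orbT.
have CD : C <= D by rewrite le_max lexx.
pose d := Num.min (e / (2 * D)) (Num.min 1 (v0 / 2)).
have d0 : 0 < d.
  by rewrite !lt_min ltr01 !divr_gt0 // mulr_gt0 //; lra.
exists (ball u0 d, ball v0 d); first by split; apply: nbhsx_ballx.
move=> [u v] [/= ub vb]; move: ub vb; rewrite /ball /= => ub vb.
have d1 : d <= 1 by rewrite !ge_min lexx !orbT.
have d2 : d <= v0 / 2 by rewrite !ge_min lexx !orbT.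
have d3 : d <= e / (2 * D) by rewrite ge_min lexx.
rewrite distrC; apply: (le_trans (fC _ _ _ _)).
- by rewrite distrC ltW // (lt_le_trans ub).
- by move: vb; rewrite ltr_distl; lra.
have : `|u - u0| + `|v - v0| <= e / D.
  rewrite distrC [`|v - _|]distrC.
  have -> : e / D = e / (2 * D) + e / (2 * D) by field; lra.
  by apply: lerD; apply: ltW; [apply: (lt_le_trans ub)|apply: (lt_le_trans vb)].
rewrite ler_pdivlMr; last lra.
apply: le_trans; rewrite mulrC ler_wpM2l // addr_ge0 //.
Qed.

(** Differences of the kernel at two points are [O(1/j^2)], so continuity needs no principal-value
    cancellation although convergence does. *)
Lemma cvg_sym_lim_kre (R : realType) (T : nat) (c : int -> R) (u0 v0 : R) :
  signed_weight T c -> 0 < v0 ->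
  (fun p : R * R => sym_lim (fun j => c j * kre p.1 p.2 j)) @ (u0, v0) -->
  sym_lim (fun j => c j * kre u0 v0 j).
Proof.
move=> cw v0_gt0; pose K := 2 * sqdist_const (`|u0| + 1) (v0 / 2).
apply: (@cvg_of_lipschitz2 R (fun u v => sym_lim (fun j => c j * kre u v j)) _ _
  (K * 8)) => // u v uu0 v0v.
have v_gt0 : 0 < v by lra.
rewrite -[K * 8 * _]mulrC [K * 8]mulrC mulrA [_ * 8]mulrC -mulrA mulrC.
apply: sym_lim_lipschitz; try exact: sym_cvg_kre cw _.
move=> j; rewrite -mulrBr normrM.
have [h _] := kernel_lipschitz u u0 j v_gt0 v0_gt0.
have u1 : `|u| <= `|u0| + 1.
  by rewrite -[u](subrK u0) (le_trans (ler_normD _ _)) // addrC lerD2l.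
have h1 := sqdist_inv_le j u1 (ltac:(lra) : 0 < v0 / 2) v0v.
have h2 := sqdist_inv_le j (ltac:(lra) : `|u0| <= `|u0| + 1)
   (ltac:(lra) : 0 < v0 / 2) (ltac:(lra) : v0 / 2 <= v0).
apply: (@le_trans _ _ (1 * ((`|u - u0| + `|v - v0|) *
  ((sqdist u v j)^-1 + (sqdist u0 v0 j)^-1)))).
  by apply: ler_pM => //; exact: signed_weight_norm cw.
rewrite mul1r -mulrA ler_wpM2l ?addr_ge0 // /K; lra.
Qed.

Lemma cvg_sym_lim_kim (R : realType) (T : nat) (c : int -> R) (u0 v0 : R) :
  signed_weight T c -> 0 < v0 ->
  (fun p : R * R => sym_lim (fun j => c j * kim p.1 p.2 j)) @ (u0, v0) -->
  sym_lim (fun j => c j * kim u0 v0 j).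
Proof.
move=> cw v0_gt0; pose K := 2 * sqdist_const (`|u0| + 1) (v0 / 2).
apply: (@cvg_of_lipschitz2 R (fun u v => sym_lim (fun j => c j * kim u v j)) _ _
  (K * 8)) => // u v uu0 v0v.
have v_gt0 : 0 < v by lra.
rewrite -[K * 8 * _]mulrC [K * 8]mulrC mulrA [_ * 8]mulrC -mulrA mulrC.
apply: sym_lim_lipschitz; try exact: sym_cvg_kim cw _.
move=> j; rewrite -mulrBr normrM.
have [_ h] := kernel_lipschitz u u0 j v_gt0 v0_gt0.
have u1 : `|u| <= `|u0| + 1.
  by rewrite -[u](subrK u0) (le_trans (ler_normD _ _)) // addrC lerD2l.
have h1 := sqdist_inv_le j u1 (ltac:(lra) : 0 < v0 / 2) v0v.
have h2 := sqdist_inv_le j (ltac:(lra) : `|u0| <= `|u0| + 1)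
   (ltac:(lra) : 0 < v0 / 2) (ltac:(lra) : v0 / 2 <= v0).
apply: (@le_trans _ _ (1 * ((`|u - u0| + `|v - v0|) *
  ((sqdist u v j)^-1 + (sqdist u0 v0 j)^-1)))).
  by apply: ler_pM => //; exact: signed_weight_norm cw.
rewrite mul1r -mulrA ler_wpM2l ?addr_ge0 // /K; lra.
Qed.

(** * Uniqueness, and S' in terms of the kernels *)

Lemma signed_weight_quad_le0 (R : realType) (T : nat) (c : int -> R) (j : int) :
  signed_weight T c -> c j * (j%:~R * (j%:~R + T%:R)) <= 0.
Proof.
move=> [ci co _].
have -> : j%:~R * (j%:~R + T%:R) = (j * (j + T%:Z))%:~R :> R.
  by rewrite rmorphM rmorphD.
case: (boolP (- T%:Z < j < 0)) => jT.
  have /andP[c0 _] := ci _ jT; apply: mulr_ge0_le0 => //.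
  by rewrite (_ : 0 = 0%:~R) // ler_int; nia.
have /andP[_ c0] := co _ jT; apply: mulr_le0_ge0 => //.
by rewrite (_ : 0 = 0%:~R) // ler_int; nia.
Qed.

(* If both [u1 + iv1] and [u2 + iv2] solve the equation, so do their conjugates;
   a linear combination of the four equations cancels the constant [l] and has
   the terms [c j * h j / (q1 j * q2 j)] with [h j = j (j + T)], none of which
   is positive. *)
Lemma pole_sum_root_unique (R : realType) (T : nat) (c : int -> R)
    (u1 v1 u2 v2 l : R) :
  signed_weight T c -> 0 < v1 -> 0 < v2 ->
  sym_lim (fun j => c j * kre u1 v1 j) = l ->
  sym_lim (fun j => c j * kim u1 v1 j) = 0 ->
  sym_lim (fun j => c j * kre u2 v2 j) = l ->
  sym_lim (fun j => c j * kim u2 v2 j) = 0 ->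
  u1 = u2 /\ v1 = v2.
Proof.
move=> cw v1_gt0 v2_gt0 re1 im1 re2 im2.
(* With [q1], [q2] the squared distances to [j], [q2 - q1 = be + al j]. Then [De = |be + al w1|^2],
   which vanishes only if the two points coincide. *)
pose al := 2 * (u1 - u2); pose be := u2 ^+ 2 + v2 ^+ 2 - (u1 ^+ 2 + v1 ^+ 2).
pose De := (be + al * u1) ^+ 2 + al ^+ 2 * v1 ^+ 2.
have [De0|De0] := eqVneq De 0.
  have al2 : 0 <= al ^+ 2 * v1 ^+ 2 by rewrite mulr_ge0 ?sqr_ge0.
  have al0 : al = 0.
    have /eqP : al ^+ 2 * v1 ^+ 2 = 0.
      by move: De0 (sqr_ge0 (be + al * u1)); rewrite /De; lra.
    by rewrite mulf_eq0 !sqrf_eq0 (gt_eqF v1_gt0) orbF => /eqP.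
  have u12 : u1 = u2 by move: al0; rewrite /al; lra.
  split => //; move: De0; rewrite /De al0 mul0r addr0 expr0n mul0r addr0 /be u12.
  move=> /eqP; rewrite sqrf_eq0 opprD addrACA subrr add0r subr_eq0.
  by rewrite eqrXn2 ?ltW // => /eqP ->.
pose t : R := T%:R; pose m1 := u1 ^+ 2 + v1 ^+ 2.
(* As polynomials in [j], [h = q1 + x (j (q2 - q1) - al q1) + y (q2 - q1)]. The coefficients of
   [j^2] agree for all [x], [y]; the other two form a linear system of determinant [De], solved by
   Cramer's rule. *)
pose x := ((t + 2 * u1) * be + al * m1) / De.
pose y := m1 * (al * t - be) / De.
pose h (j : int) : R := j%:~R * (j%:~R + t).
pose f j := c j * (h j / (sqdist u1 v1 j * sqdist u2 v2 j)).
(* Division by [q1 q2] leaves multiples of [1/q] and [j/q], where [1/q = kim / v] and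
   [j/q = u kim / v - kre]. The two [kre] get opposite coefficients [-x] and [x], so [l] cancels. *)
pose a1 := (x * u1 + y) / v1; pose a2 := (1 - x * u2 - x * al - y) / v2.
have fE j : f j = a1 * (c j * kim u1 v1 j) + a2 * (c j * kim u2 v2 j)
    - x * (c j * kre u1 v1 j) + x * (c j * kre u2 v2 j).
  have q1 := sqdist_gt0 u1 j v1_gt0; have q2 := sqdist_gt0 u2 j v2_gt0.
  have -> : f j = c j * ((sqdist u1 v1 j + x * (j%:~R * (sqdist u2 v2 j - sqdist u1 v1 j)
      - al * sqdist u1 v1 j) + y * (sqdist u2 v2 j - sqdist u1 v1 j)) /
      (sqdist u1 v1 j * sqdist u2 v2 j)).
    rewrite /f; congr (_ * (_ / _)); rewrite /h /x /y /m1 /sqdist.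
    move: De0; rewrite /De /al /be exprMn [2 ^+ 2](_ : _ = 4) => [De0|]; last by ring.
    by field.
  rewrite /kim /kre /a1 /a2.
  by field; rewrite !lt0r_neq0.
have lim_to (g : int -> R) b : sym_cvg g -> sym_lim g = b ->
    (fun M => \sum_(j <- sym_range M) g j) @ \oo --> b by move=> cg <-.
have c1 := lim_to _ _ (sym_cvg_kim cw v1_gt0) im1.
have c2 := lim_to _ _ (sym_cvg_kim cw v2_gt0) im2.
have c3 := lim_to _ _ (sym_cvg_kre cw v1_gt0) re1.
have c4 := lim_to _ _ (sym_cvg_kre cw v2_gt0) re2.
have flim : (fun M => \sum_(j <- sym_range M) f j) @ \oo --> (0 : R).
  have -> : (fun M => \sum_(j <- sym_range M) f j) = (fun M =>
      a1 * (\sum_(j <- sym_range M) c j * kim u1 v1 j)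
      + a2 * (\sum_(j <- sym_range M) c j * kim u2 v2 j)
      - x * (\sum_(j <- sym_range M) c j * kre u1 v1 j)
      + x * (\sum_(j <- sym_range M) c j * kre u2 v2 j)).
    apply/funext => M; rewrite !mulr_sumr -big_split -sumrB -big_split /=.
    by apply: eq_bigr => j _; rewrite fE.
  rewrite [X in _ --> X](_ : 0 = a1 * 0 + a2 * 0 - x * l + x * l); last by ring.

  apply: cvgD; [apply: cvgB; [apply: cvgD|]|]; apply: cvgMl_tmp.
  - exact: c1.
  - exact: c2.
  - exact: c3.
  - exact: c4.
have [_ _ [J cJ]] := cw.
have f_le0 j : f j <= 0.
  have q0 : 0 <= (sqdist u1 v1 j * sqdist u2 v2 j)^-1.
    by rewrite invr_ge0 mulr_ge0 // ltW // sqdist_gt0.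
  rewrite /f mulrA; apply: mulr_le0_ge0 => //.
  exact: signed_weight_quad_le0 cw.
(* The successor ensures [j0 > 0], hence [h j0 > 0], even when [J = 0]. *)
pose j0 : int := J.+1%:Z.
have f0 : f j0 < 0.
  rewrite /f cJ; last by rewrite /j0; lia.
  rewrite mulN1r oppr_lt0 divr_gt0 ?mulr_gt0 ?sqdist_gt0 //.
  by rewrite /h /t (_ : j0%:~R = J.+1%:R) // mulr_gt0 // ltr_pwDl.
have : 0 <= f j0.
  apply: (cvgr_to_le flim); exists (absz j0).+1 => // M /= j0M.
  rewrite -[leRHS]opprK lerNr -sumrN.
  have := @sum_uniq_le R _ [:: j0] (sym_range M) xpredT (fun j => - f j) isT.
  rewrite big_seq1; apply; rewrite ?sym_range_uniq //.
    by move=> j _; rewrite inE mem_sym_range => /eqP ->; lia.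
  by move=> j _; rewrite oppr_ge0.
by rewrite leNgt f0.
Qed.

(** * From the complex function S' to real sums over all integers *)

Lemma cvg_complex (R : realType) (I : Type) (F : set_system I) (f g : I -> R)
    (x y : R) : Filter F -> f @ F --> x -> g @ F --> y ->
  (fun i => (f i +i* g i : R[i]^o)) @ F --> (x +i* y : R[i]^o).
Proof.
move=> FF fx gy; apply/cvgrPdist_lt => -[e e'].
rewrite ltcE /= => /andP[/eqP -> e0].
have e2 : 0 < e / 2 by rewrite divr_gt0.
move/cvgrPdist_lt/(_ _ e2) : fx => fx; move/cvgrPdist_lt/(_ _ e2) : gy => gy.
near=> i.
have hf : `|x - f i| < e / 2 by near: i.
have hg : `|y - g i| < e / 2 by near: i.
rewrite normc_def /= ltcR -(ltr_pXn2r (n := 2)) ?nnegrE ?sqrtr_ge0 ?ltW //.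
rewrite sqr_sqrtr ?addr_ge0 ?sqr_ge0 //.
move: hf hg; rewrite !ltr_norml => /andP[h1 h2] /andP[h3 h4].
have : (x - f i) ^+ 2 < (e / 2) ^+ 2 by rewrite -subr_gt0 subr_sqr mulr_gt0; lra.
have : (y - g i) ^+ 2 < (e / 2) ^+ 2 by rewrite -subr_gt0 subr_sqr mulr_gt0; lra.
have := sqr_ge0 e; rewrite !expr_div_n; lra.
Unshelve. all: by end_near. Qed.

Definition occupied (a : configuration) (N : nat) (j : int) : bool :=
  [exists i, a N i == j].

Definition pole_weight (R : realType) (a : configuration) (T N : nat) (j : int) : R :=
  (occupied a N j)%:R - (~~ (- T%:Z < j < 0))%:R.

Lemma configuration_inj (a : configuration) (N : nat) :
  increasing_configuration a -> injective (a N).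
Proof.
move=> ia i j aij; apply: val_inj => /=.
by case: (ltngtP i j) => // /ia; rewrite aij ltxx.
Qed.

Lemma sum_configuration (V : nmodType) (a : configuration) (N : nat) (P : pred int)
    (f : int -> V) (s : seq int) :
  increasing_configuration a -> uniq s ->
  (forall j, occupied a N j -> P j -> j \in s) ->
  \sum_(r < N | P (a N r)) f (a N r) = \sum_(j <- s | occupied a N j && P j) f j.
Proof.
move=> ia us sa.
rewrite -(big_map (a N) P f).
set t := map _ _.
have tE j : (j \in t) = occupied a N j.
  apply/mapP/existsP => [[i _ ->]|[i /eqP <-]]; first by exists i.
  by exists i; rewrite ?mem_index_enum.
rewrite big_seq_cond (eq_bigl (fun j => occupied a N j && P j)); last first.
  by move=> j; rewrite tE.
apply: sum_uniq_eq => //.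
  by rewrite map_inj_uniq ?index_enum_uniq //; exact: configuration_inj.
by move=> j /andP[oj Pj]; rewrite tE oj sa.
Qed.

Lemma occupied_bounded (a : configuration) (N : nat) :
  exists J : nat, forall j, occupied a N j -> `|j| < J%:Z.
Proof.
exists (\max_(i < N) absz (a N i)).+1 => j /existsP[i /eqP <-].
have : (absz (a N i) <= \max_(i < N) absz (a N i))%N by exact: leq_bigmax.
lia.
Qed.

Lemma pole_weight_signed (R : realType) (a : configuration) (T N : nat) :
  signed_weight T (pole_weight R a T N).
Proof.
rewrite /pole_weight; split.
- by move=> j ->; rewrite subr0; case: occupied; rewrite ?ler01 ?lexx.
- by move=> j ->; case: occupied; rewrite ?subrr ?sub0r ?lexx ?oppr_le0 ?ler01 ?lerN10.
have [J aJ] := occupied_bounded a N; exists (maxn J T) => j jJ.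
have -> : occupied a N j = false.
  by case oj: (occupied a N j) => //; have := aJ _ oj; lia.
have -> : ~~ (- T%:Z < j < 0) by lia.
by rewrite sub0r.
Qed.

Lemma inv_complex_sub (R : realType) (u v : R) (j : int) :
  ((u +i* v) - j%:~R)^-1 = kre u v j +i* (- kim u v j) :> R[i].
Proof.
have -> : j%:~R = (j%:~R : R)%:C :> R[i] by rewrite rmorph_int.
rewrite /kre /kim /sqdist; simpc. by [].
Qed.

Lemma pv_sumE (R : realType) (t : nat) (f : int -> R[i]) (l : R[i]^o) :
  (fun M => (\sum_(j <- sym_range M | ~~ (- t%:Z < j < 0)) f j : R[i]^o)) @ \oo --> l ->
  pv_sum t f = l.
Proof.
move=> fl; have H : hausdorff_space R[i]^o by exact: norm_hausdorff.
suff /(cvg_lim H) : (fun M : nat =>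
    (\sum_(j \in Lset t `&` [set j : int | (`|j| < M%:Z)%R]) f j) : R[i]^o) @ \oo --> l.
  by [].
apply: cvg_trans fl; apply: near_eq_cvg; apply: nearW => M.
rewrite -big_filter fsbig_seq ?filter_uniq ?sym_range_uniq //.
apply: eq_fsbigl; apply/seteqP; split => j /=; rewrite mem_filter mem_sym_range.
  move=> /andP[jt jM]; split=> //; rewrite /Lset /=.
  have [j0|j0] := leP 0 j; [by right|left; lia].
by move=> [jt jM]; rewrite jM andbT; case: jt => /= ?; lia.
Qed.

Lemma S'_kernels (R : realType) (beta : R) (T : nat -> nat) (a : configuration)
    (N : nat) (x y : R) :
  increasing_configuration a -> (0 < T N)%N -> 0 < y ->
  let c := pole_weight R a (T N) N in
  let u := (T N)%:R * x in let v := (T N)%:R * y in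
  S' beta T a N (x +i* y) =
    (sym_lim (fun j => c j * kre u v j) - ln (beta^-1 - 1)) +i*
    (- sym_lim (fun j => c j * kim u v j)).
Proof.
move=> ia T0 y0 c u v.
have v0 : 0 < v by rewrite mulr_gt0 ?ltr0n.
have cw : signed_weight (T N) c by exact: pole_weight_signed.
pose g (j : int) : R[i] := kre u v j +i* (- kim u v j).
have gE j : ((T N)%:R * (x +i* y) - j%:~R)^-1 = g j.
  rewrite /g -inv_complex_sub; congr ((_ - _)^-1).
  have -> : (T N)%:R = ((T N)%:R : R)%:C by rewrite rmorph_nat.
  by rewrite /u /v; simpc.
rewrite /S'; under eq_bigr do rewrite gE.
have -> : (fun j : int => ((T N)%:R * (x +i* y) - j%:~R)^-1) = g.
  by apply/funext => j; exact: gE.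
set rl := sym_lim _; set il := sym_lim _.
(* The p.v. sum is recovered from the combined one: once [M >= J] the range contains every [a_r],
   and its truncation is the full finite sum minus [h M]. *)
rewrite (@pv_sumE _ _ _ (\sum_(r < N) g (a N r) - (rl +i* (- il)))).
  rewrite subKr.
  by simpc.
have [J aJ] := occupied_bounded a N.
pose h (M : nat) : R[i]^o := (\sum_(j <- sym_range M) c j * kre u v j) +i*
    (- \sum_(j <- sym_range M) c j * kim u v j).
have hcvg : h @ \oo --> (rl +i* (- il) : R[i]^o).
  apply: cvg_complex; first exact: sym_cvg_kre cw v0.
  by apply: cvgN; exact: sym_cvg_kim cw v0.
have : (fun M => (\sum_(r < N) g (a N r) : R[i]^o) - h M) @ \oo -->
    ((\sum_(r < N) g (a N r) : R[i]^o) - (rl +i* (- il) : R[i]^o)).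
  exact: (cvgB (cvg_cst _) hcvg).
apply: cvg_trans; apply: near_eq_cvg; exists J => // M /= JM.
have -> : h M = \sum_(j <- sym_range M) (c j)%:C * g j.
  rewrite /h -sumrN.
  elim: (sym_range M) => [|j s IH]; first by rewrite !big_nil.
  rewrite !big_cons -IH /g; simpc.
  by rewrite ?mulrN ?opprD.
rewrite (@sum_configuration _ a N xpredT g (sym_range M)) ?sym_range_uniq //; last first.
  by move=> j oj _; have := aJ _ oj; rewrite mem_sym_range; lia.
apply/eqP; rewrite subr_eq; apply/eqP.
rewrite [X in _ = X + _]big_mkcond [LHS]big_mkcond -big_split /=.
apply: eq_bigr => j _; rewrite /c /pole_weight andbT.
by case: occupied; case: (~~ _);
  rewrite ?subrr ?subr0 ?sub0r ?mul0r ?addr0 ?add0r ?rmorphN ?rmorph1 ?mulN1r ?mul1r ?subrr.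
Qed.

(** * Windows and the reflection *)

(** All that is kept of Assumption 1: long windows carry a proportion [g] of points inside (-T, 0)
    and of holes outside. The list [s] is arbitrary, so that the property survives the
    reflection. *)
Definition window_dense (R : realType) (T : nat) (c : int -> R) (g l0 B : R) : Prop :=
  forall (s : seq int) (x l : R), uniq s ->
    (forall j : int, x <= j%:~R <= x + l -> j \in s) ->
    l0 <= l -> - B <= x -> x + l <= B ->
    (- T%:R < x -> x + l < 0 -> g * l <= \sum_(j <- s | x <= j%:~R <= x + l) c j) /\
    (0 <= x \/ x + l <= - T%:R ->
       g * l <= \sum_(j <- s | x <= j%:~R <= x + l) - c j).

(** Blocks are spaced by [2 D] because adjacent closed segments share an endpoint, which a lower
    bound must not count twice. In the upper bound [sum_blocks_le] double counting is harmless. *)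
Lemma sum_blocks_ge (R : realType) (s : seq int) (f : int -> R) (x D m : R) (k : nat) :
  0 < D -> (forall j, 0 <= f j) ->
  (forall i, (i < k)%N -> m <= \sum_(j <- s | x + 2 * i%:R * D <= j%:~R <=
                              x + 2 * i%:R * D + D) f j) ->
  k%:R * m <= \sum_(j <- s | x <= j%:~R < x + 2 * k%:R * D) f j.
Proof.
move=> D0 f0; elim: k => [|k IH] h; first by rewrite mul0r sumr_ge0.
have {}IH := IH (fun i ik => h i (ltnW ik)).
have {}h := h k (ltnSn k).
rewrite -natr1 mulrDl mul1r; apply: (le_trans (lerD IH h)).
rewrite big_mkcond [X in _ + X]big_mkcond [leRHS]big_mkcond -big_split /=.
have kD : 0 <= k%:R * D by rewrite mulr_ge0 // ltW.
apply: ler_sum => j _; have := f0 j.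
by case: ifP; case: ifP; case: ifP; lra.
Qed.

Lemma sum_blocks_le (R : realType) (s : seq int) (f : int -> R) (x D m : R) (k : nat) :
  0 < D -> (forall j, 0 <= f j) ->
  (forall i, (i < k)%N -> \sum_(j <- s | x + i%:R * D <= j%:~R <=
                              x + i%:R * D + D) f j <= m) ->
  \sum_(j <- s | x <= j%:~R < x + k%:R * D) f j <= k%:R * m.
Proof.
move=> D0 f0; elim: k => [|k IH] h.
  by rewrite !mul0r addr0 big1 // => j /andP[h1 h2]; move: (le_lt_trans h1 h2); rewrite ltxx.
have {}IH := IH (fun i ik => h i (ltnW ik)).
have {}h := h k (ltnSn k).
rewrite -natr1 [_ * m]mulrDl mul1r; apply: le_trans (lerD IH h).
rewrite big_mkcond [X in _ <= X + _]big_mkcond [X in _ <= _ + X]big_mkcond -big_split /=.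
have kD : 0 <= k%:R * D by rewrite mulr_ge0 // ltW.
apply: ler_sum => j _; have := f0 j.
by case: ifP; case: ifP; case: ifP; lra.
Qed.

Lemma points_inE (R : realType) (a : configuration) (N : nat) (x y : R) (s : seq int) :
  increasing_configuration a -> uniq s ->
  (forall j, occupied a N j -> x <= j%:~R <= y -> j \in s) ->
  (points_in a N x y)%:R = \sum_(j <- s | x <= j%:~R <= y) (occupied a N j)%:R :> R.
Proof.
move=> ia us sa.
rewrite /points_in -sumr_const.
rewrite (eq_bigl (fun i => x <= (a N i)%:~R <= y)); last by move=> i; rewrite inE.
rewrite (@sum_configuration _ a N (fun j : int => x <= j%:~R <= y) (fun=> 1) s) //.
rewrite big_mkcond [RHS]big_mkcond; apply: eq_bigr => j _.
by case: occupied; case: ifP.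
Qed.

Lemma points_in_ge (R : realType) (a : configuration) (N : nat) (x y : R) (s : seq int) :
  increasing_configuration a -> uniq s ->
  \sum_(j <- s | x <= j%:~R <= y) (occupied a N j)%:R <= (points_in a N x y)%:R :> R.
Proof.
move=> ia us; have [J aJ] := occupied_bounded a N.
rewrite (@points_inE _ _ _ _ _ (sym_range J)) ?sym_range_uniq //; last first.
  by move=> j oj _; rewrite mem_sym_range aJ.
rewrite (bigID (occupied a N)) [leRHS](bigID (occupied a N)) /=.
rewrite [X in _ + X]big1; last by move=> j /andP[_ /negbTE ->].
rewrite [X in _ <= _ + X]big1; last by move=> j /andP[_ /negbTE ->].
rewrite !addr0; apply: sum_uniq_le; rewrite ?sym_range_uniq //.
by move=> j /andP[_ oj] _; rewrite mem_sym_range aJ.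
Qed.

(** Points: the spacing [2 D] and the rounding of the number of blocks (with [l >= 4 D]) each cost a
    factor 2, hence [4 g <= rlo]. Holes: at least [(l - 1) - rup (l + D)], where [1 + D] takes at
    most half of [(1 - rup) l]. The last block may overshoot the window by [D], hence
    [B + D N <= Q N]. *)
Lemma pole_weight_window_dense (R : realType) (D Q : nat -> R) (rlo rup : R)
    (a : configuration) (T N : nat) (g l0 B : R) :
  increasing_configuration a -> assumption1 D Q rlo rup a -> (0 < N)%N ->
  0 < D N -> 0 < rlo -> rlo <= rup < 1 -> 4 * g <= rlo -> 2 * g <= 1 - rup ->
  4 * D N <= l0 -> 2 * (1 + D N) <= (1 - rup) * l0 -> B + D N <= Q N ->
  window_dense T (pole_weight R a T N) g l0 B.
Proof.
move=> ia A1 N0 D0 rlo0 rlu g1 g2 Dl0 Dl1 BQ s x l us sx l0l Bx xB.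
have f0 j : 0 <= (occupied a N j)%:R :> R by case: occupied.
split.
  move=> Tx xl0.
  have -> : \sum_(j <- s | x <= j%:~R <= x + l) pole_weight R a T N j =
      \sum_(j <- s | x <= j%:~R <= x + l) (occupied a N j)%:R.
    apply: eq_bigr => j /andP[xj jx]; rewrite /pole_weight.
    have -> : - T%:Z < j < 0.
      by rewrite -!(ltr_int R) rmorphN /=; lra.
    by rewrite subr0.
  set z := l / (2 * D N); set k := absz (Num.floor z).
  have z0 : 0 <= z by rewrite divr_ge0 //; lra.
  have kE : k%:R = (Num.floor z)%:~R :> R.
    by rewrite /k natr_absz ger0_norm // floor_ge0.
  have kz : k%:R <= z by rewrite kE floor_le.
  have zk : z < k%:R + 1 by rewrite kE; have := floor_itv z; rewrite rmorphD /=; lra.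
  have kD : 2 * k%:R * D N <= l.
    by move: kz; rewrite /z ler_pdivlMr; lra.
  have Dk : l < 2 * (k%:R + 1) * D N.
    by move: zk; rewrite /z ltr_pdivrMr; lra.
  have blk i : (i < k)%N -> rlo * D N <= \sum_(j <- s | x + 2 * i%:R * D N <= j%:~R <=
       x + 2 * i%:R * D N + D N) (occupied a N j)%:R.
    move=> ik.
    have iD : 0 <= i%:R * D N by rewrite mulr_ge0 // ltW.
    have ik' : (i%:R + 1) * D N <= k%:R * D N by rewrite ler_pM2r // natr1 ler_nat.
    rewrite -points_inE //; last by move=> j _ jx; apply: sx; lra.
    by have /andP[] := A1 N (x + 2 * i%:R * D N) N0 (ltac:(lra)) (ltac:(lra)).
  have := sum_blocks_ge D0 f0 blk.
  have : \sum_(j <- s | x <= j%:~R < x + 2 * k%:R * D N) (occupied a N j)%:R <=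
         \sum_(j <- s | x <= j%:~R <= x + l) (occupied a N j)%:R :> R.
    rewrite big_mkcond [leRHS]big_mkcond; apply: ler_sum => j _; have := f0 j.
    by clear -kD; case: ifP; case: ifP; lra.
  move=> h1 h2; apply: le_trans h1; apply: le_trans h2.
  have h3 : rlo * (l / 4) <= rlo * (k%:R * D N) by rewrite ler_pM2l //; lra.
  have h4 : 4 * g * l <= rlo * l by rewrite ler_pM2r //; lra.
  lra.
move=> xout.
have -> : \sum_(j <- s | x <= j%:~R <= x + l) - pole_weight R a T N j =
    \sum_(j <- s | x <= j%:~R <= x + l) 1 -
    \sum_(j <- s | x <= j%:~R <= x + l) (occupied a N j)%:R.
  rewrite -sumrB; apply: eq_bigr => j /andP[xj jx]; rewrite /pole_weight opprB.
  have -> // : ~~ (- T%:Z < j < 0).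
  by rewrite -!(ltr_int R) rmorphN /=; case: xout; lra.
have c1 := sum_count_ge us sx.
set z := l / D N; set k := (absz (Num.floor z)).+1.
have z0 : 0 <= z by rewrite divr_ge0 //; lra.
have kE : k%:R = (Num.floor z)%:~R + 1 :> R.
  by rewrite /k -natr1 natr_absz ger0_norm // floor_ge0.
have kz : k%:R - 1 <= z by have := floor_le z; rewrite kE; lra.
have zk : z < k%:R by rewrite kE; have := floor_itv z; rewrite rmorphD /=; lra.
have kD : (k%:R - 1) * D N <= l by move: kz; rewrite /z ler_pdivlMr.
have Dk : l < k%:R * D N by move: zk; rewrite /z ltr_pdivrMr.
have blk i : (i < k)%N -> \sum_(j <- s | x + i%:R * D N <= j%:~R <=
       x + i%:R * D N + D N) (occupied a N j)%:R <= rup * D N.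
  move=> ik; apply: (le_trans (points_in_ge _ _ _ ia us)).
  have iD : 0 <= i%:R * D N by rewrite mulr_ge0 // ltW.
  have ik' : i%:R * D N <= (k%:R - 1) * D N.
    by rewrite ler_pM2r // lerBrDr natr1 ler_nat.
  by have /andP[] := A1 N (x + i%:R * D N) N0 (ltac:(lra)) (ltac:(lra)).
have := sum_blocks_le D0 f0 blk.
have : \sum_(j <- s | x <= j%:~R <= x + l) (occupied a N j)%:R <=
       \sum_(j <- s | x <= j%:~R < x + k%:R * D N) (occupied a N j)%:R :> R.
  rewrite big_mkcond [leRHS]big_mkcond; apply: ler_sum => j _; have := f0 j.
  by clear -Dk; case: ifP; case: ifP; lra.
move=> h1 h2; have h3 := le_trans h1 h2.
have h4 : rup * (k%:R * D N) <= rup * (l + D N).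
  by rewrite ler_pM2l; clear -kD rlo0 rlu; lra.
have h5 : rup * D N <= D N by rewrite ler_piMl; clear -D0 rlu; lra.
have h6 : (1 - rup) * l0 <= (1 - rup) * l.
  by rewrite ler_pM2l; clear -l0l rlu; lra.
have h7 : 2 * g * l <= (1 - rup) * l.
  by rewrite ler_pM2r; clear -g2 D0 Dl0 l0l; lra.
lra.
Qed.

(** The reflection exchanges the end points 0 and -T; it preserves the two zones and [kim], and
    changes the sign of [kre]. *)
Definition mirror (R : realType) (T : nat) (c : int -> R) (j : int) : R :=
  c (- T%:Z - j).

Lemma mirror_signed (R : realType) (T : nat) (c : int -> R) :
  signed_weight T c -> signed_weight T (mirror T c).
Proof.
move=> [ci co [J cJ]]; split.
- by move=> j jT; apply: ci; lia.
- by move=> j jT; apply: co; lia.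
by exists (J + T)%N => j jJ; apply: cJ; lia.
Qed.

Lemma mirror_sum (R : realType) (T : nat) (s : seq int) (P : pred int) (f : int -> R) :
  \sum_(j <- [seq - T%:Z - i | i <- s] | P j) f j =
  \sum_(j <- s | P (- T%:Z - j)) f (- T%:Z - j).
Proof. by rewrite big_map. Qed.

Lemma mirror_inj (T : nat) : injective (fun j : int => - T%:Z - j).
Proof. by move=> i j /addrI/oppr_inj. Qed.

Lemma mirrorK (T : nat) (j : int) : - T%:Z - (- T%:Z - j) = j.
Proof. by rewrite opprB addrC subrK. Qed.

(** The radius drops by [T], since [-(B-T), B-T] is reflected onto [-B, B-2T]. *)
Lemma mirror_window_dense (R : realType) (T : nat) (c : int -> R) (g l0 B : R) :
  window_dense T c g l0 B -> window_dense T (mirror T c) g l0 (B - T%:R).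
Proof.
move=> wd s x l us sx l0l Bx xB.
pose s' := [seq - T%:Z - i | i <- s].
have us' : uniq s' by rewrite map_inj_uniq //; exact: mirror_inj.
have jE (j : int) : ((- T%:Z - j)%:~R : R) = - T%:R - j%:~R.
  by rewrite rmorphB rmorphN.
have T0 : 0 <= T%:R :> R by [].
have pE j : (- T%:R - x - l <= (- T%:Z - j)%:~R <= - T%:R - x - l + l) =
    (x <= (j%:~R : R) <= x + l).
  by rewrite jE; apply/idP/idP; lra.
have [] := wd s' (- T%:R - x - l) l us' _ l0l (ltac:(lra)) (ltac:(lra)).
  move=> j; rewrite -{1}(mirrorK T j) -{2}(mirrorK T j) pE => /sx jx.
  by apply/mapP; exists (- T%:Z - j) => //; rewrite mirrorK.
rewrite !mirror_sum => h1 h2.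
split.
  move=> h3 h4; apply: (le_trans (h1 (ltac:(lra)) (ltac:(lra)))).
  by rewrite (eq_bigl _ _ pE).
move=> h3; apply: (le_trans (h2 (ltac:(lra)))).
by rewrite (eq_bigl _ _ pE).
Qed.

Lemma mirror_kim (R : realType) (T : nat) (u v : R) (j : int) :
  kim (- T%:R - u) v (- T%:Z - j) = kim u v j.
Proof.
rewrite /kim /sqdist rmorphB rmorphN /=; congr (_ / (_ + _)).
by rewrite -sqrrN; congr (_ ^+ 2); ring.
Qed.

Lemma mirror_kre (R : realType) (T : nat) (u v : R) (j : int) :
  kre (- T%:R - u) v (- T%:Z - j) = - kre u v j.
Proof.
rewrite /kre -mulNr /sqdist rmorphB rmorphN /=; congr (_ / (_ + _)); first by ring.
by rewrite -sqrrN; congr (_ ^+ 2); ring.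
Qed.

(** * The sign of the imaginary part *)

Lemma kim_gt0 (R : realType) (u v : R) (j : int) : 0 < v -> 0 < kim u v j.
Proof. by move=> v0; rewrite divr_gt0 // sqdist_gt0. Qed.

Lemma weighted_le (R : realType) (x y : R) : -1 <= x <= 1 -> 0 <= y -> - y <= x * y <= y.
Proof.
move=> /andP[h1 h2] y0; apply/andP; split.
  by rewrite -subr_ge0 opprK -{2}[y]mul1r -mulrDl mulr_ge0 //; lra.
by rewrite ler_piMl.
Qed.

(** Here [kim <= v / (p+n)^2], and [1/y^2 <= 2 (1/y - 1/(y+1))] for [y >= 1], which is why [1 <= p]
    is required. *)
Lemma sum_kim_half_line (R : realType) (s : seq int) (P : pred int) (idx : int -> nat)
    (u v p : R) : uniq s -> {in P &, injective idx} -> 0 < v -> 1 <= p ->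
  (forall j, P j -> p + (idx j)%:R <= `|u - j%:~R|) ->
  \sum_(j <- s | P j) kim u v j <= 2 * (v / p).
Proof.
move=> us inj v0 p1 pj.
apply: le_trans (@sum_int_tele_le R s P idx (kim u v) (fun n => v / (p + n%:R) ^+ 2)
  (fun n => - (2 * (v / (p + n%:R)))) 0 us inj _ _ _) _; last first.
- by rewrite /= sub0r opprK addr0.
- move=> n; rewrite oppr_le0 mulr_ge0 // divr_ge0 ?ltW // .
  by have : 0 <= n%:R :> R by []; lra.
- move=> n; have n0 : 0 <= n%:R :> R by [].
  rewrite divr_ge0 ?sqr_ge0 ?(ltW v0) //= -natr1.
  rewrite [leRHS](_ : _ = v * (2 / ((p + n%:R) * (p + n%:R + 1)))); last first.
    by field; apply/andP; split; apply: lt0r_neq0; lra.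
  rewrite ler_pM2l // ler_pdivlMr; last by rewrite mulr_gt0; lra.
  rewrite mulrC ler_pdivrMr; last by rewrite exprn_gt0 //; lra.
  have y1 : 1 <= p + n%:R by lra.
  move: (p + n%:R) y1 => y y1; nra.
move=> j Pj; rewrite /kim /sqdist ler_pM2l //.
have n0 : 0 <= (idx j)%:R :> R by [].
rewrite lef_pV2 ?posrE; last 2 first.
- by rewrite ltr_wpDl ?sqr_ge0 ?exprn_gt0.
- by rewrite exprn_gt0 //; lra.
rewrite -[X in _ <= X + _]real_normK ?num_real // ler_wpDr ?sqr_ge0 //.
by rewrite lerXn2r ?nnegrE ?pj //; lra.
Qed.

Lemma sum_split_zones (R : realType) (T : nat) (s : seq int) (f : int -> R) :
  (0 < T)%N ->
  \sum_(j <- s) f j = \sum_(j <- s | - T%:Z < j < 0) f j +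
    (\sum_(j <- s | 0 <= j) f j + \sum_(j <- s | j <= - T%:Z) f j).
Proof.
move=> T0; rewrite big_mkcond [in RHS]big_mkcond [X in _ + (X + _)]big_mkcond
  [X in _ + (_ + X)]big_mkcond -!big_split /=.
apply: eq_bigr => j _.
have [j0|j0] := leP 0 j; have [jT|jT] := leP j (- T%:Z); rewrite ?addr0 ?add0r //.
by exfalso; lia.
Qed.

Lemma absz_inj_ge0 : {in (fun j : int => 0 <= j) &, injective absz}.
Proof. by move=> i j; rewrite -!topredE /=; lia. Qed.

Lemma absz_inj_left (T : nat) :
  {in (fun j : int => j <= - T%:Z) &, injective (fun j => absz (- T%:Z - j))}.
Proof. by move=> i j; rewrite -!topredE /=; lia. Qed.

Lemma absz_inj_inner (T : nat) :
  {in (fun j : int => - T%:Z < j < 0) &, injective (fun j => (absz j).-1)}.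
Proof. by move=> i j; rewrite -!topredE /=; lia. Qed.

Lemma absz_inner (T : nat) (j : int) : - T%:Z < j < 0 ->
  ((absz j).-1 < T)%N /\ (absz j).-1.+1 = absz j.
Proof. by lia. Qed.

(** The point is low above (-T, 0) compared with its distances to both ends. On the window [u, u+v],
    [kim >= 1/(2v)], which yields [g/2]; each outer half line costs at most [4 sg <= g/8]. *)
Lemma im_sum_inner (R : realType) (T : nat) (c : int -> R) (g l0 B sg u v : R)
    (s : seq int) :
  signed_weight T c -> window_dense T c g l0 B -> uniq s ->
  (forall j : int, `|j%:~R| <= B -> j \in s) ->
  - T%:R < u -> u + v < 0 -> 1 <= l0 -> l0 <= v -> `|u| + v <= B ->
  0 < sg -> 32 * sg <= g -> sg <= 1 / 2 ->
  v <= 2 * sg * - u -> v <= 2 * sg * (u + T%:R) ->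
  g / 4 <= \sum_(j <- s) c j * kim u v j.
Proof.
move=> cw wd us sB Tu uv l01 l0v uvB sg0 sgg sg1 vu vuT.
have v0 : 0 < v by lra.
have u0 : 0 < - u by lra.
have uT0 : 0 < u + T%:R by lra.
have nu : 1 <= - u.
  have : 2 * sg * - u <= - u by rewrite -{2}[- u]mul1r ler_pM2r //; lra.
  lra.
have nuT : 1 <= u + T%:R.
  have : 2 * sg * (u + T%:R) <= u + T%:R.
    by rewrite -{2}[u + T%:R]mul1r ler_pM2r //; lra.
  lra.
have k0 j := ltW (kim_gt0 u j v0).
have ck j : - kim u v j <= c j * kim u v j <= kim u v j.
  by apply: weighted_le => //; rewrite -ler_norml; exact: signed_weight_norm cw.
pose I j := - T%:Z < j < 0.
pose W (j : int) := u <= j%:~R <= u + v.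
have WI j : W j -> I j.
  by move=> /andP[h1 h2]; rewrite /I -!(ltr_int R) rmorphN /=; lra.
have uB : `|u| <= B by lra.
have [uB1 uB2] : - B <= u /\ u + v <= B.
  by split; [move: uB; rewrite ler_norml; lra|move: (ler_norm u); lra].
have WB j : W j -> j \in s.
  by move=> /andP[h1 h2]; apply: sB; rewrite ler_norml; lra.
have [h _] := wd s u v us WB l0v uB1 uB2.
have {}h := h Tu uv.
have hW : g / 2 <= \sum_(j <- s | W j) c j * kim u v j.
  apply: (@le_trans _ _ (\sum_(j <- s | W j) c j * (1 / (2 * v)))).
    rewrite -mulr_suml.
    rewrite (_ : g / 2 = g * v * (1 / (2 * v))); last by field; lra.
    by rewrite ler_pM2r // divr_gt0 // mulr_gt0.
  apply: ler_sum => j Wj; have [ci _ _] := cw.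
  have /andP[c0 _] := ci j (WI j Wj); apply: ler_wpM2l => //.
  rewrite /kim /sqdist ler_pdivlMr; last exact: sqdist_gt0.
  rewrite mulrC mulrA mulr1 ler_pdivrMr; last by rewrite mulr_gt0.
  rewrite mulrCA -expr2.
  have : (u - j%:~R) ^+ 2 <= v ^+ 2.
    have jv : `|u - j%:~R| <= v.
      by rewrite ler_norml; move: Wj; rewrite /W => /andP[h1 h2]; lra.
    by rewrite -[leLHS]real_normK ?num_real // lerXn2r ?nnegrE // ltW.
  lra.
have T1 : (0 < T)%N by rewrite -(ltr_nat R); lra.
rewrite (sum_split_zones s (fun j => c j * kim u v j) T1) -/I.
have hI : g / 2 <= \sum_(j <- s | I j) c j * kim u v j.
  apply: (le_trans hW); rewrite [leRHS](bigID W) /=.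
  rewrite [X in _ <= X + _](eq_bigl W); last first.
    by move=> j; case Wj: (W j); rewrite ?andbF // WI.
  rewrite lerDl sumr_ge0 // => j /andP[Ij _]; apply: mulr_ge0 => //.
  by have [ci _ _] := cw; case/andP: (ci j Ij).
have h2 : - (4 * sg) <= \sum_(j <- s | 0 <= j) c j * kim u v j.
  apply: (@le_trans _ _ (\sum_(j <- s | 0 <= j) - kim u v j)); last first.
    by apply: ler_sum => j _; case/andP: (ck j).
  rewrite sumrN lerN2.
  apply: (le_trans (@sum_kim_half_line _ _ _ absz u v (- u) us absz_inj_ge0 v0 nu _)).
  - move=> j j0; rewrite -normrN; apply: le_trans (ler_norm _).
    by rewrite natr_absz ger0_norm //; lra.
  by rewrite (_ : 4 * sg = 2 * (2 * sg)) ?ler_pM2l ?ler_pdivrMr //; lra.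
have h3 : - (4 * sg) <= \sum_(j <- s | j <= - T%:Z) c j * kim u v j.
  apply: (@le_trans _ _ (\sum_(j <- s | j <= - T%:Z) - kim u v j)); last first.
    by apply: ler_sum => j _; case/andP: (ck j).
  rewrite sumrN lerN2.
  apply: (le_trans (@sum_kim_half_line _ _ _ (fun j => absz (- T%:Z - j)) u v
    (u + T%:R) us (@absz_inj_left T) v0 nuT _)).
  - move=> j jT; apply: le_trans (ler_norm _).
    by rewrite natr_absz ger0_norm ?subr_ge0 // rmorphB rmorphN /=; lra.
  by rewrite (_ : 4 * sg = 2 * (2 * sg)) ?ler_pM2l ?ler_pdivrMr //; lra.
lra.
Qed.

(** This is |1 + r e^{i phi}|^2 with [co = cos phi]. *)
Definition polarE (R : realType) (r co : R) : R := 1 + 2 * r * co + r ^+ 2.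

(* The point [u + iv = - t / (1 + r e^{i phi})], with [co = cos phi] and
   [si = sin phi], whose distances to [-t] and [0] have ratio [r]. *)
Definition polar_u (R : realType) (t r co : R) : R := - (t * (1 + r * co) / polarE r co).
Definition polar_v (R : realType) (t r co si : R) : R := t * r * si / polarE r co.

Lemma polarE_gt0 (R : realType) (r co si : R) : co ^+ 2 + si ^+ 2 = 1 -> 0 < r ->
  0 < si -> 0 < polarE r co.
Proof.
move=> cs r0 s0; rewrite /polarE.
have -> : 1 + 2 * r * co + r ^+ 2 = (1 + r * co) ^+ 2 + (r * si) ^+ 2.
  rewrite exprMn (_ : si ^+ 2 = 1 - co ^+ 2); last by rewrite -cs addrC addKr.
  by ring.
by rewrite ltr_wpDl ?sqr_ge0 // exprn_gt0 // mulr_gt0.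
Qed.

(* Affine in [co], which makes each term of the sum of [c j / sqdist] monotone in [co]. *)
Lemma polar_sqdist (R : realType) (t r co si : R) (j : int) :
  co ^+ 2 + si ^+ 2 = 1 -> 0 < r -> 0 < si ->
  polarE r co * sqdist (polar_u t r co) (polar_v t r co si) j =
  (t + j%:~R) ^+ 2 + r ^+ 2 * j%:~R ^+ 2 + 2 * r * co * j%:~R * (j%:~R + t).
Proof.
move=> cs r0 s0; have E0 := polarE_gt0 cs r0 s0.
rewrite /sqdist /polar_v !expr_div_n [(t * r * si) ^+ 2]exprMn.
rewrite (_ : si ^+ 2 = 1 - co ^+ 2); last by rewrite -cs addrC addKr.
rewrite /polar_u; move: E0; rewrite /polarE => E0.
by field; exact: lt0r_neq0.
Qed.

(** Holes in a window of length [v] within horizontal distance [2v] of the point have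
    [kim >= 1/(5v)] and yield [g/5]; the poles in (-T, 0) contribute at most [2 si <= g/16]. *)
Lemma im_sum_outer (R : realType) (T : nat) (c : int -> R) (g l0 B r co si : R)
    (s : seq int) :
  let u := polar_u T%:R r co in let v := polar_v T%:R r co si in
  signed_weight T c -> window_dense T c g l0 B -> uniq s ->
  (forall j : int, `|j%:~R| <= B -> j \in s) ->
  (0 < T)%N -> co ^+ 2 + si ^+ 2 = 1 -> 1 <= r -> 0 < si -> co <= - (1 / 2) ->
  l0 <= v -> `|u| + v <= B -> 32 * si <= g ->
  \sum_(j <- s) c j * kim u v j <= - (g / 10).
Proof.
move=> u v cw wd us sB T0 cs r1 s0 co2 l0v uvB sg.
have r0 : 0 < r by lra.
have t0 : 0 < T%:R :> R by rewrite ltr0n.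
pose t : R := T%:R.
have E0 := polarE_gt0 cs r0 s0.
have v0 : 0 < v by rewrite divr_gt0 // !mulr_gt0.
have co1 : -1 <= co by have := sqr_ge0 si; nra.
have si1 : si <= 1 by have := sqr_ge0 co; nra.
(* Amounts to [1 + r co <= r si]. It follows from [si - co >= 1], as [si] and [- co] lie in [0, 1]
   and their squares sum to 1. *)
have uv : - u <= v.
  rewrite /u opprK /polar_v ler_pM2r ?invr_gt0 // -mulrA ler_pM2l //.
  have : 1 <= si - co.
    by rewrite -cs; have := mulr_ge0 (ltac:(lra) : 0 <= si) (ltac:(lra) : 0 <= 1 - si);
       have := mulr_ge0 (ltac:(lra) : 0 <= - co) (ltac:(lra) : 0 <= 1 + co); lra.
  move=> h; have := mulr_ge0 (ltac:(lra) : 0 <= r - 1) (ltac:(lra) : 0 <= si - co); lra.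
have k0 j := ltW (kim_gt0 u j v0).
have ck j : - kim u v j <= c j * kim u v j <= kim u v j.
  by apply: weighted_le => //; rewrite -ler_norml; exact: signed_weight_norm cw.
pose I j := - T%:Z < j < 0.
(* The point may project into (-T, 0); the window is then moved to start at 0, and [- u <= v] keeps
   it close enough. *)
pose x := Num.max u 0.
have x0 : 0 <= x by rewrite le_max lexx orbT.
have ux : u <= x by rewrite le_max lexx.
have xu : x <= `|u| by rewrite ge_max ler_norm normr_ge0.
have xv : x - v <= u by rewrite /x maxEle; case: ifP; lra.
pose W (j : int) := x <= j%:~R <= x + v.
have WI j : W j -> ~~ I j.
  by move=> /andP[h1 h2]; rewrite /I -!(ltr_int R) rmorphN /=; lra.
have [_ h] := wd s x v us (fun j jw => sB j (ltac:(rewrite ler_norml; lra)))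
  l0v (ltac:(lra)) (ltac:(lra)).
have {}h := h (or_introl x0).
have hW : g / 5 <= \sum_(j <- s | W j) - (c j * kim u v j).
  apply: (@le_trans _ _ (\sum_(j <- s | W j) - c j * (1 / (5 * v)))).
    rewrite -mulr_suml.
    rewrite (_ : g / 5 = g * v * (1 / (5 * v))); last by field; lra.
    by rewrite ler_pM2r // divr_gt0 // mulr_gt0.
  apply: ler_sum => j Wj; have [_ c_out _] := cw.
  have /andP[_ c0] := c_out j (WI j Wj); rewrite -mulNr; apply: ler_wpM2l => //.
    by rewrite oppr_ge0.
  rewrite /kim /sqdist ler_pdivlMr; last exact: sqdist_gt0.
  rewrite mulrC mulrA mulr1 ler_pdivrMr; last by rewrite mulr_gt0.
  rewrite mulrCA -expr2.
  have : (u - j%:~R) ^+ 2 <= (2 * v) ^+ 2.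
    rewrite -[leLHS]real_normK ?num_real // lerXn2r ?nnegrE //; first by lra.
    by rewrite ler_norml; move: Wj; rewrite /W => /andP[h1 h2]; lra.
  rewrite exprMn; lra.
have hI : \sum_(j <- s | I j) c j * kim u v j <= 2 * si.
  apply: (@le_trans _ _ (\sum_(j <- s | I j) kim u v j)).
    by apply: ler_sum => j _; case/andP: (ck j).
  (* For [j = - n] and [co <= -1/2] the squared distance times [polarE] is at least
     [a^2 + b^2 + a b >= (a+b)^2 / 2], with [a = t - n], [b = r n] and [a + b = A n]. *)
  pose A (n : nat) : R := t + (r - 1) * n%:R.
  have At n : t <= A n by rewrite lerDl mulr_ge0 //; lra.
  have A0 n : 0 < A n by exact: lt_le_trans t0 (At n).
  (* [n / A n] has increments [t / (A n * A n.+1)], and its value at [T] is [1 / r]. Freezing it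
     beyond [T] keeps it bounded and monotone. *)
  pose F (n : nat) := (2 * r * si) * ((minn n T)%:R / A (minn n T)).
  pose G (n : nat) := if (n < T)%N then 2 * t * r * si / A n.+1 ^+ 2 else 0.
  have := @sum_int_tele_le R s I (fun j => (absz j).-1) (kim u v) G F (2 * si) us.
  rewrite /F min0n mul0r mulr0 subr0; apply.
  - exact: absz_inj_inner.
  - move=> j Ij; rewrite /G; have [-> ->] := absz_inner Ij.
    have jn : (absz j)%:R = - j%:~R :> R.
      by rewrite natr_absz ltr0_norm ?rmorphN //; case/andP: Ij.
    have jT : 0 < t + j%:~R.
      by case/andP: Ij => + _; rewrite -(ltr_int R) rmorphN /=; rewrite /t; lra.
    have j0 : 0 < - j%:~R :> R.
      by case/andP: Ij => _; rewrite -(ltr_int R); lra.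
    rewrite /kim /v /polar_v -mulrA -invfM polar_sqdist // -/t.
    rewrite (_ : 2 * t * r * si = t * r * si * 2); last by ring.
    rewrite -[leRHS]mulrA ler_pM2l; last by rewrite !mulr_gt0.
    rewrite ler_pdivlMr ?exprn_gt0 //.
    rewrite mulrC ler_pdivrMr; last first.
      have := sqdist_gt0 (polar_u t r co) j v0.
      by rewrite -(pmulr_rgt0 _ E0) polar_sqdist.
    rewrite /A jn.
    have := mulr_ge0 (mulr_ge0 (ltac:(lra) : 0 <= r) (ltac:(lra) : 0 <= - co - 1 / 2))
      (ltW (mulr_gt0 j0 jT)).
    have := sqr_ge0 (t + j%:~R - r * - j%:~R).
    have := sqr_ge0 (t + j%:~R + r * - j%:~R).
    move: (j%:~R : R) => z; nra.
  - move=> n; rewrite /G /F; case: ltnP => nT; last first.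
      by rewrite !(minn_idPr _) ?(leq_trans nT) // subrr lexx.
    rewrite !(minn_idPl _) // ?(ltnW nT) //.
    rewrite divr_ge0 ?sqr_ge0 ?mulr_ge0 ?(ltW t0) ?(ltW r0) ?(ltW s0) //= -mulrBr.
    have -> : n.+1%:R / A n.+1 - n%:R / A n = t / (A n * A n.+1).
      have := A0 n; have := A0 n.+1; rewrite /A -natr1 => h1 h2.
      by field; rewrite !lt0r_neq0.
    rewrite (_ : 2 * t * r * si = 2 * r * si * t); last by ring.
    rewrite -mulrA ler_pM2l ?mulr_gt0 // ler_pM2l //.
    rewrite lef_pV2 ?posrE ?mulr_gt0 ?exprn_gt0 // expr2 ler_pM2r //.
    by rewrite /A -natr1; lra.
  - move=> n; rewrite (_ : 2 * r * si = 2 * si * r); last by ring.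
    rewrite -mulrA ger_pMr; last by rewrite mulr_gt0.
    rewrite mulrA ler_pdivrMr // mul1r /A.
    have : (minn n T)%:R <= t :> R by rewrite ler_nat geq_minr.
    lra.
rewrite (bigID I) /=.
have hO : g / 5 <= - \sum_(j <- s | ~~ I j) c j * kim u v j.
  apply: (le_trans hW); rewrite -sumrN [leRHS](bigID W) /=.
  rewrite [X in _ <= X + _](eq_bigl W); last first.
    by move=> j; case Wj: (W j); rewrite ?andbF // WI.
  rewrite lerDl sumr_ge0 // => j /andP[Ij _]; rewrite -mulNr; apply: mulr_ge0 => //.
  by have [_ c_out _] := cw; case/andP: (c_out j Ij) => _; rewrite oppr_ge0.
lra.
Qed.

(** * The real part near the points 0 and -T *)

Lemma kre_abs_le (R : realType) (u v : R) (j : int) : 0 < v ->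
  `|kre u v j| <= 1 / (2 * v).
Proof.
move=> v0; have q0 := sqdist_gt0 u j v0.
rewrite /kre normrM normfV [`|sqdist _ _ _|]gtr0_norm // ler_pdivrMr //.
rewrite mul1r mulrC ler_pdivlMr; last by rewrite mulr_gt0.
rewrite /sqdist -[X in _ <= X + _]real_normK ?num_real //.
by have := sqr_ge0 (`|u - j%:~R| - v); lra.
Qed.

(** At scale [p = 2^n] a window of length [p mu] has weight at least [g p mu], and there
    [v <= u - j <= 5 p mu] gives [kre >= 1/(10 p mu)]. So every scale contributes [g/10]. *)
Lemma re_dyadic_sum (R : realType) (T : nat) (c : int -> R) (g l0 B u v mu : R)
    (s : seq int) (n : nat) :
  signed_weight T c -> window_dense T c g l0 B -> uniq s ->
  (forall j : int, - T%:Z < j < 0 -> j \in s) -> T%:R <= B -> 0 < g ->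
  0 < v -> v <= mu -> `|u| <= mu -> l0 <= mu -> 2 ^+ n.+1 * mu < T%:R ->
  n%:R * g / 10 <= \sum_(j <- s | (- T%:Z < j < 0) &&
    (- (3 * 2 ^+ n * mu) < j%:~R <= - (3 * mu))) c j * kre u v j.
Proof.
move=> cw wd us sT TB g0 v0 vmu umu l0mu.
have mu0 : 0 < mu by exact: lt_le_trans vmu.
have [ci _ _] := cw.
move: umu; rewrite ler_norml => /andP[u1 u2].
have kpos j : j%:~R <= - (3 * mu) -> 0 <= kre u v j.
  by move=> jmu; rewrite divr_ge0 ?(ltW (sqdist_gt0 _ _ _)) //; lra.
elim: n => [|n IH] nT.
  rewrite !mul0r sumr_ge0 // => j /andP[jT /andP[_ j3]].
  by rewrite mulr_ge0 ?kpos //; case/andP: (ci j jT).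
set p : R := 2 ^+ n in IH nT *.
have pE : 2 ^+ n.+1 = 2 * p by rewrite exprS.
have pE2 : 2 ^+ n.+2 = 4 * p by rewrite exprS pE; ring.
rewrite pE2 in nT; rewrite pE in IH *.
have p1 : 1 <= p by rewrite exprn_ege1 // ler1n.
have pmu : mu <= p * mu by rewrite ler_peMl // ltW.
have {}IH := IH (ltac:(lra)).
(* The window ends at [- 3 p mu], just where the half-open range of the induction hypothesis stops,
   so no term is used twice. *)
pose W (j : int) := - (4 * p * mu) <= j%:~R <= - (4 * p * mu) + p * mu.
have WI j : W j -> - T%:Z < j < 0.
  by rewrite /W => /andP[h1 h2]; rewrite -!(ltr_int R) rmorphN /=; lra.
have [h _] := wd s (- (4 * p * mu)) (p * mu) us (fun j Wj => sT j (WI j Wj))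
  (ltac:(lra)) (ltac:(lra)) (ltac:(lra)).
have {}h := h (ltac:(lra)) (ltac:(lra)).
have hW : g / 10 <= \sum_(j <- s | W j) c j * kre u v j.
  apply: (@le_trans _ _ (\sum_(j <- s | W j) c j * (1 / (10 * (p * mu))))).
    rewrite -mulr_suml.
    rewrite (_ : g / 10 = g * (p * mu) * (1 / (10 * (p * mu)))); last first.
      by field; rewrite !lt0r_neq0 //; lra.
    by rewrite ler_pM2r // divr_gt0 //; lra.
  apply: ler_sum => j Wj; have /andP[c0 _] := ci j (WI j Wj).
  apply: ler_wpM2l => //; rewrite /kre ler_pdivlMr; last exact: sqdist_gt0.
  rewrite div1r mulrC ler_pdivrMr; last by lra.
  move: Wj; rewrite /W /sqdist => /andP[h1 h2].
  have d1 : v <= u - j%:~R by lra.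
  have d2 : u - j%:~R <= 5 * (p * mu) by lra.
  move: (u - j%:~R) d1 d2 => d d1 d2.
  have e1 : v ^+ 2 <= d ^+ 2 by rewrite lerXn2r ?nnegrE //; lra.
  have e2 : d * d <= d * (5 * (p * mu)) by rewrite ler_pM2l //; lra.
  rewrite expr2 in e1 *; lra.
rewrite -natr1 mulrDl mul1r mulrDl.
apply: (le_trans (lerD IH hW)).
rewrite big_mkcond [X in _ + X]big_mkcond [leRHS]big_mkcond -big_split /=.
apply: ler_sum => j _.
case Ij: (- T%:Z < j < 0) => /=; last first.
  by case Wj: (W j); rewrite ?addr0 //; move: (WI j Wj); rewrite Ij.
have /andP[c0 _] := ci j Ij.
have cp : j%:~R <= - (3 * mu) -> 0 <= c j * kre u v j.
  by move=> jm; rewrite mulr_ge0 // kpos.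
clear -cp mu0 pmu; rewrite /W; case: ifP => h1; case: ifP => h2; case: ifP => h3;
  rewrite ?addr0 ?add0r //; try lra.
Qed.

(** Apart from the dyadic gain, the sign of a term can be wrong only for [|j| <= mu], where at most
    [2 mu + 1] terms of size [1/(2v)] cost [la + 1/2], and for [-5T <= j <= -T], where at most [5T]
    terms of size [2/T] cost 10. *)
Lemma re_near_ge (R : realType) (T : nat) (c : int -> R) (g l0 B u v la : R)
    (s : seq int) (n : nat) :
  signed_weight T c -> window_dense T c g l0 B -> uniq s ->
  (forall j : int, - T%:Z < j < 0 -> j \in s) ->
  (forall j : int, j \in s -> - (5 * T%:Z) <= j) ->
  (0 < T)%N -> T%:R <= B -> 0 < g -> 1 <= v -> l0 <= v -> 1 <= la ->
  `|u| <= la * v -> `|u| <= T%:R / 2 -> 2 ^+ n.+1 * (la * v) < T%:R ->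
  n%:R * g / 10 - la - 11 <= \sum_(j <- s) c j * kre u v j.
Proof.
move=> cw wd us sT s5 T0 TB g0 v1 l0v la1 ula uT nT.
have v0 : 0 < v by lra.
have t0 : 1 <= T%:R :> R by rewrite ler1n.
set mu := la * v in ula nT.
have vmu : v <= mu by rewrite ler_peMl // ltW.
pose P (j : int) := (- T%:Z < j < 0) &&
  (- (3 * 2 ^+ n * mu) < j%:~R <= - (3 * mu)).
have hd : n%:R * g / 10 <= \sum_(j <- s | P j) c j * kre u v j.
  exact: re_dyadic_sum cw wd us sT TB g0 v0 vmu ula (le_trans l0v vmu) nT.
have [ci co _] := cw.
pose e1 (j : int) : R := if - mu <= j%:~R <= mu then 1 else 0.
pose e2 (j : int) : R := if - (5 * T%:R) <= (j%:~R : R) <= - T%:R then 1 else 0.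
move: ula uT; rewrite !ler_norml => /andP[u1 u2] /andP[u3 u4].
have key (j : int) : j \in s -> (if P j then c j * kre u v j else 0)
    - e1 j * (1 / (2 * v)) - e2 j * (2 / T%:R) <= c j * kre u v j.
  move=> js; clear hd nT wd us sT TB l0v vmu g0; have q0 := sqdist_gt0 u j v0.
  have kb := kre_abs_le u j v0.
  have i1 : 0 <= 1 / (2 * v) by rewrite divr_ge0 //; lra.
  have i2 : 0 <= 2 / T%:R :> R by rewrite divr_ge0.
  have e10 : 0 <= e1 j * (1 / (2 * v)) by rewrite mulr_ge0 // /e1; case: ifP.
  have e20 : 0 <= e2 j * (2 / T%:R) by rewrite mulr_ge0 // /e2; case: ifP.
  have ck : - (1 / (2 * v)) <= c j * kre u v j.
    have := signed_weight_norm j cw => cn.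
    have : `|c j * kre u v j| <= 1 / (2 * v).
      by rewrite normrM -[leRHS]mul1r ler_pM.
    by rewrite ler_norml => /andP[].
  have ck1 : - mu <= j%:~R <= mu -> - (e1 j * (1 / (2 * v))) <= c j * kre u v j.
    by move=> jm; rewrite /e1 jm mul1r.
  have pos : j%:~R <= u -> 0 <= kre u v j by move=> ju; rewrite divr_ge0 ?(ltW q0) //; lra.
  have neg : u <= j%:~R -> kre u v j <= 0.
    by move=> ju; rewrite mulr_le0_ge0 ?invr_ge0 ?(ltW q0) //; lra.
  case: ifP => [_|Pj]; first by lra.
  case Ij: (- T%:Z < j < 0).
    have /andP[c0 _] := ci j Ij.
    have [ju|uj] := leP (j%:~R) u; first by have := mulr_ge0 c0 (pos ju); lra.
    have j0 : j%:~R < 0 :> R by case/andP: Ij => _; rewrite -(ltr_int R).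
    by have := ck1 (ltac:(lra)); lra.
  have /andP[c1 c0] := co j (negbT Ij).
  have [j0|j0] := leP 0 j.
    have j0' : 0 <= j%:~R :> R by rewrite ler0z.
    have [uj|ju] := leP u (j%:~R); first by have := mulr_le0 c0 (neg uj); lra.
    by have := ck1 (ltac:(lra)); lra.
  have jT : j <= - T%:Z by move: Ij; rewrite j0 andbT; case: ltP.
  have jT' : j%:~R <= - T%:R :> R by move: jT; rewrite -(ler_int R) rmorphN.
  have j5 : - (5 * T%:R) <= j%:~R :> R.
    by have := s5 j js; rewrite -(ler_int R) rmorphN rmorphM.
  have k2 : kre u v j <= 2 / T%:R.
    rewrite /kre ler_pdivrMr // mulrAC ler_pdivlMr; last by lra.
    rewrite /sqdist; move: (u - j%:~R) (ltac:(lra) : T%:R / 2 <= u - j%:~R) => d hd2.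
    have := sqr_ge0 v; have : d * (T%:R / 2) <= d * d by rewrite ler_pM2l //; lra.
    by rewrite expr2; lra.
  have k0 := pos (ltac:(clear -jT' u3 t0; lra)).
  have /andP[h1 _] := weighted_le (ltac:(lra) : -1 <= c j <= 1) k0.
  by move: e20; rewrite /e2 j5 jT' /= mul1r; lra.
apply: (@le_trans _ _ (\sum_(j <- s) ((if P j then c j * kre u v j else 0)
    - e1 j * (1 / (2 * v)) - e2 j * (2 / T%:R)))); last first.
  by rewrite big_seq [leRHS]big_seq; apply: ler_sum => j js; exact: key.
rewrite !sumrB -big_mkcond -!mulr_suml /=.
have m0 : 0 <= mu by lra.
have f1 : \sum_(j <- s) e1 j <= 2 * mu + 1.
  rewrite -big_mkcond; apply: (le_trans (sum_count_le us _)); lra.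
have f2 : \sum_(j <- s) e2 j <= 5 * T%:R.
  rewrite -big_mkcond; apply: (le_trans (sum_count_le us _)); lra.
have f3 : (\sum_(j <- s) e1 j) * (1 / (2 * v)) <= la + 1 / 2.
  apply: (@le_trans _ _ ((2 * mu + 1) * (1 / (2 * v)))).
    by rewrite ler_pM2r // divr_gt0 //; lra.
  rewrite /mu div1r ler_pdivrMr; lra.
have f4 : (\sum_(j <- s) e2 j) * (2 / T%:R) <= 10.
  by rewrite mulrA ler_pdivrMr; lra.
lra.
Qed.

(** Since [|j| >= 4 T] is at least twice |w|, [sqdist >= j^2 / 4] and each term is at most
    [16 T / j^2]. Each sign then contributes at most [16 T / (4 T - 1) <= 16/3 < 11/2]. *)
Lemma sum_far_kernel (R : realType) (T : nat) (s : seq int) (u v : R) :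
  (0 < T)%N -> uniq s -> 0 < v -> u ^+ 2 + v ^+ 2 <= (2 * T%:R) ^+ 2 ->
  \sum_(j <- s | (4 * T%:Z) <= `|j|) `|kre u v j + (j%:~R)^-1| <= 11.
Proof.
move=> T0 us v0 wT.
have t1 : 1 <= T%:R :> R by rewrite ler1n.
have u2T : `|u| <= 2 * T%:R.
  have tt : 0 <= 2 * T%:R :> R by lra.
  rewrite -(ler_pXn2r (n := 2)) ?nnegrE // real_normK ?num_real //.
  by have := sqr_ge0 v; lra.
set t : R := T%:R in t1 wT u2T *.
have term (j : int) : 4 * T%:Z <= `|j| ->
    `|kre u v j + (j%:~R)^-1| <= 16 * t / (`|j|%N%:R) ^+ 2.
  move=> j4; have jr : 4 * t <= `|j%:~R|.
    by rewrite -intr_norm /t -[T%:R]/(T%:Z%:~R) -[4]/(4%:Z%:~R) -intrM ler_int.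
  have j0 : j != 0 by lia.
  have q0 := sqdist_gt0 u j v0.
  rewrite kre_invD // natr_absz.
  rewrite normrM normfV normrM [`|sqdist _ _ _|]gtr0_norm // intr_norm.
  move: u2T; rewrite ler_norml => /andP[u1 u2].
  have qj : `|j%:~R| ^+ 2 / 4 <= sqdist u v j.
    have h : `|j%:~R| / 2 <= `|u - j%:~R|.
      have := ler_normD (j%:~R - u) u; rewrite subrK distrC.
      have : `|u| <= 2 * t by rewrite ler_norml; lra.
      lra.
    rewrite /sqdist -[X in _ <= X + _]real_normK ?num_real //.
    have := sqr_ge0 v.
    have : (`|j%:~R| / 2) ^+ 2 <= `|u - j%:~R| ^+ 2 by rewrite lerXn2r ?nnegrE //; lra.
    rewrite expr_div_n; lra.
  have nb : `|u ^+ 2 + v ^+ 2 - u * j%:~R| <= 4 * t * `|j%:~R|.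
    apply: (le_trans (ler_normB _ _)); rewrite [`|u * _|]normrM.
    have m0 : 0 <= u ^+ 2 + v ^+ 2 by rewrite addr_ge0 ?sqr_ge0.
    rewrite (ger0_norm m0).
    have h1 : `|u| * `|j%:~R| <= 2 * t * `|j%:~R|.
      by rewrite ler_wpM2r // ler_norml; lra.
    have h2 : t * (4 * t) <= t * `|j%:~R| by rewrite ler_pM2l //; lra.
    rewrite expr2 in wT; lra.
  have jp : 0 < `|j%:~R| :> R by lra.
  rewrite ler_pdivrMr ?mulr_gt0 // mulrAC ler_pdivlMr ?exprn_gt0 //.
  move: (`|j%:~R|) jp qj nb => y y0 qj nb.
  have := ler_pM (normr_ge0 _) (sqr_ge0 y) nb (ltac:(lra) : y ^+ 2 <= 4 * sqdist u v j).
  move=> /le_trans; apply; lra.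
have half (P : pred int) : {in P &, injective absz} ->
    (forall j, P j -> 4 * T%:Z <= `|j|) ->
    \sum_(j <- s | P j) `|kre u v j + (j%:~R)^-1| <= 11 / 2.
  move=> inj Pj.
  have := @sum_int_tele_le R s P (fun j => absz j - 4 * T)%N
    (fun j => `|kre u v j + (j%:~R)^-1|) (fun n => 16 * t / (n%:R + 4 * t) ^+ 2)
    (fun n => - (16 * t / (n%:R + 4 * t - 1))) 0 us.
  have -> : 0 - - (16 * t / (0%:R + 4 * t - 1)) = 16 * t / (4 * t - 1).
    by rewrite sub0r opprK add0r.
  move=> h; apply: (le_trans (h _ _ _ _)).
  - move=> i j iP jP e; apply: inj => //; move: (Pj _ iP) (Pj _ jP) e; lia.
  - move=> j jP; apply: (le_trans (term j (Pj j jP))).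
    have -> : (absz j - 4 * T)%N%:R + 4 * t = (absz j)%:R :> R.
      by rewrite natrB ?natrM ?subrK //; move: (Pj _ jP); lia.
    by [].
  - move=> n; have n0 : 0 <= n%:R :> R by [].
    have t16 : 0 <= 16 * t by lra.
    rewrite divr_ge0 ?sqr_ge0 //=.
    rewrite -natr1 opprK addrC.
    rewrite [leRHS](_ : _ = 16 * t * (1 / ((n%:R + 4 * t - 1) * (n%:R + 4 * t)))); last first.
      by field; apply/andP; split; apply: lt0r_neq0; lra.
    rewrite ler_pM2l; last by lra.
    have y0 : 0 < n%:R + 4 * t - 1 by lra.
    have y1 : 0 < n%:R + 4 * t by lra.
    rewrite div1r lef_pV2 ?posrE ?mulr_gt0 ?exprn_gt0 // expr2 ler_pM2r //; lra.
  - move=> n; have n0 : 0 <= n%:R :> R by [].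
    by rewrite oppr_le0 divr_ge0; lra.
  by rewrite ler_pdivrMr; lra.
rewrite (bigID (fun j : int => 0 <= j)) /=.
rewrite (_ : 11 = 11 / 2 + 11 / 2); last by lra.
apply: lerD; apply: half => [i j|j /andP[] //];
  by rewrite -!topredE /=; clear; lia.
Qed.

(** Assumption 2 with R = 4 and delta = 1 covers [|a_r| <= N]; the remaining points, at most N of
    them, contribute less than [1/N] each. *)
Lemma sum_far_inv (R : realType) (T : nat -> nat) (A : R -> R -> R)
    (Nmin : R -> R -> nat) (a : configuration) (N : nat) :
  increasing_configuration a -> assumption2 T A Nmin a -> (0 < N)%N ->
  (Nmin 4%R 1%R <= N)%N ->
  `| \sum_(r < N | (4 * (T N)%:Z) <= `|a N r|) ((a N r)%:~R)^-1 : R | <= A 4 1 + 1.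
Proof.
move=> ia A2 N0 NN.
have N0R : 0 < N%:R :> R by rewrite ltr0n.
rewrite (bigID (fun r => `|(a N r)%:~R| <= 1 * N%:R :> R)) /=.
apply: (le_trans (ler_normD _ _)); apply: lerD.
  have := A2 1 4 ltr01 (ltac:(lra)) N N0 NN.
  congr (`|_| <= _); apply: eq_bigl => r; congr (_ && _).
  by rewrite -intr_norm -[(T N)%:R]/((T N)%:Z%:~R) -[4]/(4%:Z%:~R) -intrM ler_int.
apply: (le_trans (ler_norm_sum _ _ _)).
apply: (@le_trans _ _ (\sum_(r < N) (N%:R)^-1)); last first.
  by rewrite sumr_const card_ord -[leLHS]mulr_natr mulVf ?lt0r_neq0.
rewrite big_mkcond; apply: ler_sum => r _; case: ifP => [/andP[_]|_].
  rewrite mul1r -ltNge => h; rewrite normfV lef_pV2 ?posrE //; last exact: lt_trans h.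
  exact: ltW.
by rewrite invr_ge0 ltW.
Qed.

(** Replace [kre] by [-1/j] at cost 11. For these [j] the weight is [occupied - 1]: the constant
    part cancels by symmetry, the other is [sum_far_inv]. *)
Lemma re_far_le (R : realType) (T : nat -> nat) (A : R -> R -> R)
    (Nmin : R -> R -> nat) (a : configuration) (N : nat) (u v : R) :
  increasing_configuration a -> assumption2 T A Nmin a -> (0 < N)%N ->
  (Nmin 4%R 1%R <= N)%N -> (0 < T N)%N -> 0 < v ->
  u ^+ 2 + v ^+ 2 <= (2 * (T N)%:R) ^+ 2 ->
  exists M0 : nat, forall M, (M0 <= M)%N ->
  `| \sum_(j <- sym_range M | 4 * (T N)%:Z <= `|j|)
       pole_weight R a (T N) N j * kre u v j | <= A 4 1 + 12.
Proof.
move=> ia A2 N0 NN T0 v0 wT.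
have [J aJ] := occupied_bounded a N.
exists (J + 4 * T N)%N => M JM.
pose far (j : int) := 4 * (T N)%:Z <= `|j|.
pose c := pole_weight R a (T N) N.
have -> : \sum_(j <- sym_range M | far j) c j * kre u v j =
    \sum_(j <- sym_range M | far j) c j * (kre u v j + (j%:~R)^-1) -
    \sum_(j <- sym_range M | far j) c j * (j%:~R)^-1.
  by rewrite -sumrB; apply: eq_bigr => j _; rewrite mulrDr addrK.
rewrite (_ : A 4 1 + 12 = 11 + (A 4 1 + 1)); last by ring.
apply: (le_trans (ler_normB _ _)); apply: lerD.
  apply: (le_trans (ler_norm_sum _ _ _)).
  apply: le_trans (sum_far_kernel T0 (sym_range_uniq M) v0 wT).
  apply: ler_sum => j _; rewrite normrM ler_piMl //.
  exact: signed_weight_norm (pole_weight_signed R a (T N) N).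
have -> : \sum_(j <- sym_range M | far j) c j * (j%:~R)^-1 =
    \sum_(j <- sym_range M | far j) (occupied a N j)%:R * (j%:~R)^-1 -
    \sum_(j <- sym_range M | far j) (j%:~R)^-1.
  rewrite -sumrB; apply: eq_bigr => j fj; rewrite /c /pole_weight.
  have -> : ~~ (- (T N)%:Z < j < 0) by move: fj; rewrite /far; clear -T0; lia.
  by rewrite mulrBl mul1r.
have -> : \sum_(j <- sym_range M | far j) (j%:~R)^-1 = 0 :> R.
  have := sum_sym_inv R M; rewrite (bigID far) /=.
  rewrite [X in _ + X = _](@sum_uniq_eq _ _ (sym_range (4 * T N)) _ _)
    ?sym_range_uniq //; last first.
    move=> j; rewrite /far -ltNge !mem_sym_range; clear -JM; lia.
  rewrite [X in _ + X = _](_ : _ = 0) ?addr0 //.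
  rewrite -[RHS](sum_sym_inv R (4 * T N)) [RHS]big_seq big_seq_cond.
  apply: eq_bigl => j; rewrite mem_sym_range /far; clear; lia.
rewrite subr0 (_ : \sum_(j <- _ | _) _ =
    \sum_(j <- sym_range M | occupied a N j && far j) (j%:~R)^-1); last first.
  rewrite [RHS](eq_bigl (fun j => far j && occupied a N j)); last first.
    by move=> j; rewrite andbC.
  rewrite [RHS]big_mkcondr; apply: eq_bigr => j _.
  by case: occupied; rewrite ?mul1r ?mul0r.
rewrite -(@sum_configuration _ a N far (fun j => (j%:~R)^-1)) ?sym_range_uniq //.
  exact: sum_far_inv A2 N0 NN.
move=> j oj _; have := aJ j oj; rewrite mem_sym_range; clear -JM; lia.
Qed.

(* Near [0] the poles of weight +1 to the left of [u] accumulate a logarithm. *)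
Lemma re_right_end (R : realType) (T : nat -> nat) (A : R -> R -> R)
    (Nmin : R -> R -> nat) (a : configuration) (N : nat) (g l0 B u v la : R) (n : nat) :
  let c := pole_weight R a (T N) N in
  increasing_configuration a -> assumption2 T A Nmin a -> (0 < N)%N ->
  (Nmin 4%R 1%R <= N)%N -> (0 < T N)%N -> window_dense (T N) c g l0 B ->
  (T N)%:R <= B -> 0 < g -> 1 <= v -> l0 <= v -> 1 <= la ->
  `|u| <= la * v -> `|u| <= (T N)%:R / 2 -> v <= (T N)%:R ->
  2 ^+ n.+1 * (la * v) < (T N)%:R ->
  n%:R * g / 10 - la - 23 - A 4 1 <= sym_lim (fun j => c j * kre u v j).
Proof.
move=> c ia A2 N0 NN T0 wd TB g0 v1 l0v la1 ula uT vT nT.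
have v0 : 0 < v by lra.
have cw : signed_weight (T N) c by exact: pole_weight_signed.
have u2 : u ^+ 2 <= (T N)%:R ^+ 2.
  by rewrite -[leLHS]real_normK ?num_real // lerXn2r ?nnegrE //; lra.
have v2 : v ^+ 2 <= (T N)%:R ^+ 2 by rewrite lerXn2r ?nnegrE //; lra.
have wT : u ^+ 2 + v ^+ 2 <= (2 * (T N)%:R) ^+ 2.
  by have := sqr_ge0 ((T N)%:R : R); rewrite exprMn; lra.
apply: sym_lim_ge; first exact: sym_cvg_kre cw v0.
have [M0 hM] := re_far_le ia A2 N0 NN T0 v0 wT.
exists (M0 + 4 * T N)%N => M MM.
have {hM} := hM M (leq_trans (leq_addr _ _) MM); rewrite ler_norml => /andP[hf _].
have hn : n%:R * g / 10 - la - 11 <= \sum_(j <- sym_range (4 * T N)) c j * kre u v j.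
  apply: (re_near_ge cw wd (sym_range_uniq _) _ _ T0 TB g0 v1 l0v la1 ula uT nT).
  - by move=> j; rewrite mem_sym_range; clear; lia.
  - by move=> j; rewrite mem_sym_range; clear; lia.
rewrite (bigID (fun j : int => 4 * (T N)%:Z <= `|j|)) /=.
rewrite [X in _ <= _ + X](_ : _ = \sum_(j <- sym_range (4 * T N)) c j * kre u v j).
  by rewrite /c in hn *; lra.
rewrite [LHS](@sum_uniq_eq _ _ (sym_range (4 * T N)) _ _) ?sym_range_uniq //; last first.
  by move=> j; rewrite -ltNge !mem_sym_range; clear -MM; lia.
rewrite [RHS]big_seq big_seq_cond.
by apply: eq_bigl => j; rewrite mem_sym_range; clear; lia.
Qed.

(** Only the terms [|j| < 4 T] are reflected, since the far bound is two-sided. The reflected list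
    lies in (-5T, 3T), whence the [5 T] in [re_near_ge]. *)
Lemma re_left_end (R : realType) (T : nat -> nat) (A : R -> R -> R)
    (Nmin : R -> R -> nat) (a : configuration) (N : nat) (g l0 B u v la : R) (n : nat) :
  let c := pole_weight R a (T N) N in
  let u' := - (T N)%:R - u in
  increasing_configuration a -> assumption2 T A Nmin a -> (0 < N)%N ->
  (Nmin 4%R 1%R <= N)%N -> (0 < T N)%N -> window_dense (T N) c g l0 B ->
  2 * (T N)%:R <= B -> 0 < g -> 1 <= v -> l0 <= v -> 1 <= la ->
  `|u'| <= la * v -> `|u'| <= (T N)%:R / 2 -> v <= (T N)%:R ->
  2 ^+ n.+1 * (la * v) < (T N)%:R ->
  n%:R * g / 10 - la - 23 - A 4 1 <= - sym_lim (fun j => c j * kre u v j).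
Proof.
move=> c u' ia A2 N0 NN T0 wd TB g0 v1 l0v la1 ula uT vT nT.
have v0 : 0 < v by lra.
have cw : signed_weight (T N) c by exact: pole_weight_signed.
have u2 : u ^+ 2 <= (3 / 2 * (T N)%:R) ^+ 2.
  have uu : `|u| <= 3 / 2 * (T N)%:R by move: uT; rewrite /u' !ler_norml; lra.
  by rewrite -[leLHS]real_normK ?num_real // lerXn2r ?nnegrE // (le_trans _ uu).
have v2 : v ^+ 2 <= (T N)%:R ^+ 2 by rewrite lerXn2r ?nnegrE //; lra.
have wT : u ^+ 2 + v ^+ 2 <= (2 * (T N)%:R) ^+ 2.
  have := sqr_ge0 ((T N)%:R : R); rewrite exprMn in u2; rewrite exprMn.
  by rewrite (_ : (3 / 2) ^+ 2 = 9 / 4) in u2; [lra|field].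
rewrite lerNr; apply: sym_lim_le; first exact: sym_cvg_kre cw v0.
have [M0 hM] := re_far_le ia A2 N0 NN T0 v0 wT.
exists (M0 + 4 * T N)%N => M MM.
have {hM} := hM M (leq_trans (leq_addr _ _) MM); rewrite ler_norml => /andP[_ hf].
pose s := [seq - (T N)%:Z - i | i <- sym_range (4 * T N)].
have us : uniq s by rewrite map_inj_uniq ?sym_range_uniq //; exact: mirror_inj.
have hn : n%:R * g / 10 - la - 11 <= - \sum_(j <- sym_range (4 * T N)) c j * kre u v j.
  have := @re_near_ge R (T N) (mirror (T N) c) g l0 (B - (T N)%:R) u' v la s n
    (mirror_signed cw) (mirror_window_dense wd) us.
  rewrite mirror_sum -sumrN => h.
  rewrite (eq_bigr (fun j => mirror (T N) c (- (T N)%:Z - j) *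
    kre u' v (- (T N)%:Z - j))); last first.
    by move=> j _; rewrite /mirror mirrorK mirror_kre mulrN.
  apply: h => //; last by lra.
    move=> j jT; apply/mapP; exists (- (T N)%:Z - j); last by rewrite mirrorK.
    by rewrite mem_sym_range; move: jT; clear; lia.
  by move=> _ /mapP[j + ->]; rewrite mem_sym_range; clear; lia.
rewrite (bigID (fun j : int => 4 * (T N)%:Z <= `|j|)) /=.
rewrite [X in _ + X <= _](_ : _ = \sum_(j <- sym_range (4 * T N)) c j * kre u v j).
  by rewrite /c in hn *; lra.
rewrite [LHS](@sum_uniq_eq _ _ (sym_range (4 * T N)) _ _) ?sym_range_uniq //; last first.
  by move=> j; rewrite -ltNge !mem_sym_range; clear -MM; lia.
rewrite [RHS]big_seq big_seq_cond.
by apply: eq_bigl => j; rewrite mem_sym_range; clear; lia.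
Qed.

(** * Existence *)

Lemma cvg_pair_at (R : realType) (I : Type) (F : set_system I) (f g : I -> R) (x y : R) :
  Filter F -> f @ F --> x -> g @ F --> y -> (fun i => (f i, g i)) @ F --> (x, y).
Proof.
move=> FF fx gy.
exact: (@cvg_pair _ _ _ F (nbhs x) (nbhs y) _ _ _ f g fx gy).
Qed.

(* [f] vanishes along a continuous curve [c = C r], on which [g] changes sign. *)
Lemma ivt_two_variables (R : realType) (f g : R -> R -> R) (a b c0 c1 : R) :
  a <= b -> c0 <= c1 ->
  (forall r c, a <= r <= b -> c0 <= c <= c1 ->
     (fun p : R * R => f p.1 p.2) @ (r, c) --> f r c) ->
  (forall r c, a <= r <= b -> c0 <= c <= c1 ->
     (fun p : R * R => g p.1 p.2) @ (r, c) --> g r c) ->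
  (forall r c c', a <= r <= b -> c0 <= c -> c < c' -> c' <= c1 -> f r c < f r c') ->
  (forall r, a <= r <= b -> f r c0 < 0 < f r c1) ->
  (forall c, c0 <= c <= c1 -> g a c <= 0 <= g b c) ->
  exists r c, [/\ a <= r <= b, c0 <= c <= c1, f r c = 0 & g r c = 0].
Proof.
move=> ab c01 cf cg fmono fsign gsign.
(* Clamping to [a, b] lets the implicit curve be defined and continuous on all of R. *)
pose cl (y : R) := Num.max a (Num.min y b).
have clab y : a <= cl y <= b by rewrite /cl maxEle minEle; do 2!case: ifP; lra.
have clcvg y0 : cl @ y0 --> cl y0.
  apply/cvgrPdist_lt => e e0.
  have idcvg : (fun y => y) @ y0 --> y0 by exact: cvg_id.
  move/cvgrPdist_lt/(_ e e0) : idcvg => idcvg; near=> y.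
  apply: (@le_lt_trans _ _ `|y0 - y|); last first.
    by near: y; exact: idcvg.
  have h1 := ler_norm (y0 - y); have h2 := ler_norm (- (y0 - y)).
  rewrite normrN in h2; rewrite ler_norml /cl !maxEle !minEle.
  by clear -ab h1 h2; do 4!case: ifP; lra.
have ccvg (y0 c : R) : (fun y => (cl y, c)) @ y0 --> (cl y0, c).
  by apply: cvg_pair_at; [exact: clcvg|exact: cvg_cst].
have exC y : exists c, (c0 < c < c1) /\ f (cl y) c = 0.
  have fs := fsign _ (clab y); have /andP[fs0 fs1] := fs.
  have [||c] := @IVT R (f (cl y)) c0 c1 0 c01.
  - apply: continuous_in_subspaceT => c; rewrite inE /= in_itv /= => cin.
    apply: (cvg_comp (fun c => (cl y, c)) (fun p : R * R => f p.1 p.2) _ (cf _ _ (clab y) cin)).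
    by apply: cvg_pair_at; [exact: cvg_cst|exact: cvg_id].
  - by rewrite ge_min (ltW fs0) le_max (ltW fs1) orbT.
  rewrite in_itv /= => /andP[cc0 cc1] fc; exists c; split=> //.
  rewrite !lt_neqAle cc0 cc1 !andbT; apply/andP; split; apply/eqP => e.
    by move: fs0; rewrite e fc ltxx.
  by move: fs1; rewrite -e fc ltxx.
have [C hC] := choice exC.
have Ccvg y0 : C @ y0 --> C y0.
  apply/cvgrPdist_lt => e e0.
  have [/andP[C0 C1] fC] := hC y0.
  (* The strict signs of [f] at [cm] and [cp] persist for [y] near [y0], and monotonicity in the
     second variable traps [C y] between them. *)
  pose cm := Num.max c0 (C y0 - e / 2); pose cp := Num.min c1 (C y0 + e / 2).
  have [m0 m1 m2] : [/\ c0 <= cm, cm < C y0 & C y0 - e / 2 <= cm].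
    by clear -C0 C1 e0; split; rewrite /cm maxEle; case: ifP; lra.
  have [p0 p1 p2] : [/\ cp <= c1, C y0 < cp & cp <= C y0 + e / 2].
    by clear -C0 C1 e0; split; rewrite /cp minEle; case: ifP; lra.
  have fm : f (cl y0) cm < 0 by rewrite -fC; apply: fmono => //; exact: ltW.
  have fp : 0 < f (cl y0) cp by rewrite -fC; apply: fmono => //; exact: ltW.
  have gm : (fun y => f (cl y) cm) @ y0 --> f (cl y0) cm.
    have cin : c0 <= cm <= c1 by lra.
    exact: (cvg_comp _ (fun p : R * R => f p.1 p.2) (ccvg y0 cm) (cf _ _ (clab y0) cin)).
  have gp : (fun y => f (cl y) cp) @ y0 --> f (cl y0) cp.
    have cin : c0 <= cp <= c1 by lra.
    exact: (cvg_comp _ (fun p : R * R => f p.1 p.2) (ccvg y0 cp) (cf _ _ (clab y0) cin)).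
  near=> y.
  have hm : f (cl y) cm < 0 by near: y; exact: (cvgr_lt _ gm).
  have hp : 0 < f (cl y) cp by near: y; exact: (cvgr_gt _ gp).
  have [/andP[Cy0 Cy1] fCy] := hC y.
  have cmC : cm < C y.
    rewrite ltNge; apply/negP; rewrite le_eqVlt => /orP[/eqP e'|lt].
      by move: hm; rewrite -e' fCy ltxx.
    have := fmono _ _ _ (clab y) (ltW Cy0) lt (ltW (lt_trans m1 C1)).
    by rewrite fCy => h; move: (lt_trans h hm); rewrite ltxx.
  have Ccp : C y < cp.
    rewrite ltNge; apply/negP; rewrite le_eqVlt => /orP[/eqP e'|lt].
      by move: hp; rewrite e' fCy ltxx.
    have := fmono _ _ _ (clab y) (ltW (lt_trans C0 p1)) lt (ltW Cy1).
    by rewrite fCy => h; move: (lt_trans h hp); rewrite ltxx.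
  rewrite ltr_norml; move: cmC Ccp m2 p2 e0; clear; lra.
have Cin y : c0 <= C y <= c1 by have [/andP[h1 h2] _] := hC y; rewrite !ltW.
have Gcont : continuous (fun y => g (cl y) (C y)).
  move=> y0; apply: (cvg_comp (fun y => (cl y, C y)) (fun p : R * R => g p.1 p.2) _
    (cg _ _ (clab y0) (Cin y0))).
  by apply: cvg_pair_at; [exact: clcvg|exact: Ccvg].
have cla : cl a = a by clear -ab; rewrite /cl maxEle minEle; do 2!case: ifP; lra.
have clb : cl b = b by clear -ab; rewrite /cl maxEle minEle; do 2!case: ifP; lra.
have [||y _ gy] := @IVT R (fun y => g (cl y) (C y)) a b 0 ab.
- exact: continuous_subspaceT.
- have := gsign _ (Cin a); have := gsign _ (Cin b); rewrite cla clb ge_min le_max.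
  by move=> /andP[_ ->] /andP[-> _]; rewrite orbT.
exists (cl y), (C y); split => //; by have [] := hC y.
Unshelve. all: by end_near. Qed.

(** Inverting [r] swaps the distances to [-t] and [0]: it is the reflection in the line Re w =
    -t/2. *)
Lemma polar_u_inv (R : realType) (t r co : R) : r != 0 -> polarE r co != 0 ->
  polar_u t r^-1 co = - t - polar_u t r co.
Proof.
move=> r0; rewrite /polar_u /polarE => E0; field.
by rewrite E0 r0.
Qed.

Lemma polar_v_inv (R : realType) (t r co si : R) : r != 0 -> polarE r co != 0 ->
  polar_v t r^-1 co si = polar_v t r co si.
Proof.
move=> r0; rewrite /polar_v /polarE => E0; field.
by rewrite E0 r0.
Qed.

Definition sine_of (R : realType) (co : R) : R := Num.sqrt (1 - co ^+ 2).

Lemma sine_ofP (R : realType) (co : R) : -1 < co < 1 ->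
  co ^+ 2 + sine_of co ^+ 2 = 1 /\ 0 < sine_of co.
Proof.
move=> /andP[h1 h2]; have h : 0 < 1 - co ^+ 2.
  by have := mulr_gt0 (ltac:(lra) : 0 < 1 - co) (ltac:(lra) : 0 < 1 + co); lra.
by rewrite sqr_sqrtr ?ltW // sqrtr_gt0 addrC subrK.
Qed.

Lemma cvg_polar (R : realType) (t r co : R) : 0 < r -> -1 < co < 1 ->
  (fun p : R * R => (polar_u t p.1 p.2, polar_v t p.1 p.2 (sine_of p.2))) @ (r, co) -->
  (polar_u t r co, polar_v t r co (sine_of co)).
Proof.
move=> r0 coI; have [cs s0] := sine_ofP coI.
have E0 := polarE_gt0 cs r0 s0.
have cr : (fun p : R * R => p.1) @ (r, co) --> r by exact: cvg_fst.
have cc : (fun p : R * R => p.2) @ (r, co) --> co by exact: cvg_snd.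
have cE : (fun p : R * R => (polarE p.1 p.2)^-1) @ (r, co) --> (polarE r co)^-1.
  apply: cvgV; first exact: lt0r_neq0.
  rewrite /polarE; under eq_fun do rewrite expr2.
  rewrite expr2; apply: cvgD; last by apply: cvgM.
  by apply: cvgD; [exact: cvg_cst|apply: cvgM => //; apply: cvgM => //; exact: cvg_cst].
have csi : (fun p : R * R => sine_of p.2) @ (r, co) --> sine_of co.
  have c1 : (fun p : R * R => 1 - p.2 ^+ 2) @ (r, co) --> 1 - co ^+ 2.
    exact: (cvgB (cvg_cst (1 : R)) (cvgM cc cc)).
  exact: (cvg_comp _ (@Num.sqrt R) c1 (@sqrt_continuous R _)).
apply: cvg_pair_at.
  apply: cvgN; apply: cvgM => //; apply: cvgM; first exact: cvg_cst.
  by apply: cvgD; [exact: cvg_cst|apply: cvgM].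
by apply: cvgM => //; apply: cvgM => //; apply: cvgM => //; exact: cvg_cst.
Qed.

(* The sum of [c j * kim] divided by [v * polarE]: the same sign as the sum, but
   with terms [c j / (polarE * sqdist)] that increase with [co]. *)
Lemma polar_im_increasing (R : realType) (T : nat) (c : int -> R) (r co co' : R) :
  let im x := sym_lim (fun j => c j * kim (polar_u T%:R r x) (polar_v T%:R r x (sine_of x)) j) in
  signed_weight T c -> (0 < T)%N -> 0 < r -> -1 < co -> co < co' -> co' < 1 ->
  im co / (T%:R * r * sine_of co) < im co' / (T%:R * r * sine_of co').
Proof.
move=> im cw T0 r0 h1 h2 h3.
have t0 : 0 < T%:R :> R by rewrite ltr0n.
pose q x (j : int) : R := polarE r x * sqdist (polar_u T%:R r x) (polar_v T%:R r x (sine_of x)) j.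
have facts x : -1 < x < 1 -> [/\ 0 < T%:R * r * sine_of x, (forall j, 0 < q x j),
    (fun M => \sum_(j <- sym_range M) c j / q x j) @ \oo --> im x / (T%:R * r * sine_of x)
    & forall j, q x j = (T%:R + j%:~R) ^+ 2 + r ^+ 2 * j%:~R ^+ 2 +
        2 * r * x * j%:~R * (j%:~R + T%:R)].
  move=> xI; have [cs s0] := sine_ofP xI.
  have E0 := polarE_gt0 cs r0 s0.
  have v0 : 0 < polar_v T%:R r x (sine_of x) by rewrite divr_gt0 // !mulr_gt0.
  have k0 : 0 < T%:R * r * sine_of x by rewrite !mulr_gt0.
  split => //; last by move=> j; rewrite /q polar_sqdist.
    by move=> j; rewrite mulr_gt0 // sqdist_gt0.
  have -> : (fun M => \sum_(j <- sym_range M) c j / q x j) = (fun M =>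
      (\sum_(j <- sym_range M) c j * kim (polar_u T%:R r x)
         (polar_v T%:R r x (sine_of x)) j) * (T%:R * r * sine_of x)^-1).
    apply/funext => M; rewrite mulr_suml; apply: eq_bigr => j _.
    have q0 := sqdist_gt0 (polar_u T%:R r x) j v0.
    rewrite /q /kim {2}/polar_v; move: q0 E0 => q0 E0.
    by field; rewrite !lt0r_neq0.
  by apply: cvgMr_tmp; exact: sym_cvg_kim cw v0.
have [k1 q1 l1 e1] := facts co (ltac:(lra)).
have [k2 q2 l2 e2] := facts co' (ltac:(lra)).
have [_ _ [J cJ]] := cw.
pose d (j : int) := c j / q co' j - c j / q co j.
have dE j : d j = - (2 * r * (co' - co)) * (c j * (j%:~R * (j%:~R + T%:R))) /
    (q co j * q co' j).
  have := q1 j; have := q2 j => h4 h5.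
  have -> : d j = c j * (q co j - q co' j) / (q co j * q co' j).
    by rewrite /d; field; rewrite !lt0r_neq0.
  by congr (_ / _); rewrite e1 e2; ring.
have d0 j : 0 <= d j.
  rewrite dE mulNr mulr_ge0 ?invr_ge0 ?(ltW (mulr_gt0 (q1 j) (q2 j))) //.
  rewrite oppr_ge0 mulr_ge0_le0 //; first by rewrite !mulr_ge0 //; lra.
  exact: signed_weight_quad_le0.
pose j0 : int := J.+1%:Z.
have dj0 : 0 < d j0.
  rewrite dE cJ; last by rewrite /j0; clear; lia.
  have hx : 0 < J.+1%:R * (J.+1%:R + T%:R) :> R.
    by rewrite mulr_gt0 ?addr_gt0 ?ltr0Sn.
  have hy : 0 < 2 * r * (co' - co) by rewrite !mulr_gt0 // subr_gt0.
  rewrite mulN1r mulrNN (_ : j0%:~R = J.+1%:R) //.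
  by rewrite divr_gt0 // mulr_gt0.
have : d j0 <= im co' / (T%:R * r * sine_of co') - im co / (T%:R * r * sine_of co).
  apply: (cvgr_to_ge (cvgB l2 l1)); exists (absz j0).+1 => // M /= j0M.
  rewrite -[leRHS]/(\sum_(j <- sym_range M) c j / q co' j -
                    \sum_(j <- sym_range M) c j / q co j) -sumrB.
  have := @sum_uniq_le R _ [:: j0] (sym_range M) xpredT d isT.
  rewrite big_seq1; apply; rewrite ?sym_range_uniq //.
  by move=> j _; rewrite inE mem_sym_range => /eqP ->; move: j0M; clear; lia.
lra.
Qed.

(** Below: [polarE <= (1+r)^2 <= 4 K r]. Above: [polarE] equals both [(1 + r co)^2 + (r si)^2] and
    [(r + co)^2 + si^2], so [2 s1 x <= s1^2 + x^2 <= 2 polarE] for [x = r si] and for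
    [x = |1 + r co|]. *)
Lemma polar_bounds (R : realType) (t r co si s1 K : R) :
  0 < t -> 0 < s1 -> s1 <= si -> co ^+ 2 + si ^+ 2 = 1 -> 1 <= K ->
  K^-1 <= r <= K ->
  [/\ t * (s1 / (4 * K)) <= polar_v t r co si, polar_v t r co si <= t * s1^-1
    & `|polar_u t r co| <= t * s1^-1].
Proof.
move=> t0 s10 s1si cs K1 /andP[Kr rK].
have K0 : 0 < K by lra.
have r0 : 0 < r by rewrite (lt_le_trans _ Kr) // invr_gt0.
have s0 : 0 < si by lra.
have Kr1 : 1 <= K * r by rewrite -ler_pdivrMl // mulr1.
have co1 : co <= 1 by have := sqr_ge0 si; nra.
have E0 := polarE_gt0 cs r0 s0.
have si2 : si ^+ 2 = 1 - co ^+ 2 by rewrite -cs addrC addKr.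
have E1 : polarE r co = (1 + r * co) ^+ 2 + (r * si) ^+ 2.
  by rewrite exprMn si2 /polarE; ring.
have E2 : polarE r co = (r + co) ^+ 2 + si ^+ 2 by rewrite si2 /polarE; ring.
have Es : s1 ^+ 2 <= polarE r co.
  have : s1 ^+ 2 <= si ^+ 2 by rewrite lerXn2r ?nnegrE //; lra.
  by have := sqr_ge0 (r + co); lra.
split.
- rewrite /polar_v -mulrA -mulrA ler_pM2l // mulrA ler_pdivlMr // mulrAC ler_pdivrMr ?mulr_gt0 //.
  have E4 : polarE r co <= 4 * K * r.
    rewrite /polarE; have : r * co <= r by rewrite ler_piMr // ltW.
    have : r * r <= K * r by rewrite ler_pM2r.
    have : r <= K * r by rewrite ler_peMl // ltW.
    by rewrite expr2; lra.
  have h1 : s1 * polarE r co <= si * polarE r co by rewrite ler_pM2r.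
  have h2 : si * polarE r co <= si * (4 * K * r) by rewrite ler_pM2l.
  by rewrite (le_trans h1) //; lra.
- rewrite /polar_v -mulrA -mulrA ler_pM2l // mulrA ler_pdivrMr // ler_pdivlMl //.
  by have := sqr_ge0 (s1 - r * si); have := sqr_ge0 (1 + r * co); lra.
rewrite /polar_u normrN -mulrA normrM (gtr0_norm t0) ler_pM2l //.
rewrite normrM normfV (gtr0_norm E0) ler_pdivrMr // ler_pdivlMl //.
have := sqr_ge0 (s1 - `|1 + r * co|); have := sqr_ge0 (r * si).
have : `|1 + r * co| ^+ 2 = (1 + r * co) ^+ 2 by rewrite real_normK ?num_real.
lra.
Qed.

(** At [r = K] the point is close to 0, as [polarE >= (K-1)^2]. The factor [3 / s1] comes from
    [1 + K <= 3 K si / s1]. *)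
Lemma polar_end_bounds (R : realType) (t K co si s1 : R) :
  0 < t -> 0 < s1 -> s1 <= si -> co ^+ 2 + si ^+ 2 = 1 -> 6 <= K ->
  [/\ `|polar_u t K co| <= 3 / s1 * polar_v t K co si,
      `|polar_u t K co| <= t / 2 & polar_v t K co si <= 2 * t / K].
Proof.
move=> t0 s10 s1si cs K6.
have K0 : 0 < K by lra.
have s0 : 0 < si by lra.
have E0 := polarE_gt0 cs K0 s0.
have co1 : co <= 1 by have := sqr_ge0 si; nra.
have co2 : -1 <= co by have := sqr_ge0 si; nra.
have si1 : si <= 1 by have := sqr_ge0 co; nra.
have Kco : K * co <= K by rewrite ler_piMr // ltW.
have Kco' : - K <= K * co by rewrite -mulrN1 ler_pM2l.
have nu : `|1 + K * co| <= 1 + K by rewrite ler_norml; lra.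
have uE : `|polar_u t K co| = t * (`|1 + K * co| / polarE K co).
  rewrite /polar_u normrN -mulrA normrM (gtr0_norm t0).
  by rewrite normrM normfV (gtr0_norm E0).
have EK : (K - 1) ^+ 2 <= polarE K co by rewrite /polarE sqrrB1; lra.
have K6K : 6 * K <= K * K by rewrite ler_pM2r.
rewrite sqrrB1 expr2 in EK.
split.
- rewrite uE /polar_v.
  have -> : 3 / s1 * (t * K * si / polarE K co) =
      t * ((3 / s1 * (K * si)) / polarE K co).
    by field; rewrite !lt0r_neq0.
  rewrite ler_pM2l // ler_pM2r ?invr_gt0 //.
  apply: (le_trans nu); rewrite mulrAC ler_pdivlMr //.
  have h1 : K * s1 <= K * si by rewrite ler_pM2l.
  have h2 : s1 <= K * s1 by rewrite ler_peMl; lra.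
  lra.
- rewrite uE ler_pM2l // ler_pdivrMr //; lra.
rewrite /polar_v ler_pdivrMr // [leRHS]mulrAC ler_pdivlMr //.
have h1 : t * K * si * K <= t * K * K.
  by rewrite -mulrA ler_pM2l ?mulr_gt0 // ler_piMl // ltW.
have h2 : t * (K * K) <= t * (2 * polarE K co) by rewrite ler_pM2l //; lra.
lra.
Qed.

Lemma sym_range_cover (R : realType) (B : R) : exists M0 : nat, forall M, (M0 <= M)%N ->
  forall j : int, `|j%:~R| <= B -> j \in sym_range M.
Proof.
exists (Num.truncn B).+1 => M MB j jB; rewrite mem_sym_range.
have h : `|j|%:~R < (Num.truncn B).+1%:R :> R.
  by rewrite intr_norm (le_lt_trans jB) // truncnS_gt.
rewrite -[_.+1%:R]/((Num.truncn B).+1%:Z%:~R) ltr_int in h.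
by move: h MB; clear; lia.
Qed.

(** Over the common factor [T / polarE], the distances [-u], [u + T] and the height [v] are
    [1 + r co], [r^2 + r co] and [r si]. As [2 co >= 1], [im_sum_inner] applies with [sg = si]. *)
Lemma polar_im_pos (R : realType) (T : nat) (c : int -> R) (g l0 B r co si : R) :
  let u := polar_u T%:R r co in let v := polar_v T%:R r co si in
  signed_weight T c -> window_dense T c g l0 B -> (0 < T)%N ->
  co ^+ 2 + si ^+ 2 = 1 -> 0 < r -> 0 < si -> 32 * si <= g -> si <= 1 / 2 ->
  1 / 2 <= co -> 1 <= l0 -> l0 <= v -> `|u| + v <= B ->
  g / 4 <= sym_lim (fun j => c j * kim u v j).
Proof.
move=> u v cw wd T0 cs r0 s0 sg s12 co2 l01 l0v uvB.
have t0 : 0 < T%:R :> R by rewrite ltr0n.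
have E0 := polarE_gt0 cs r0 s0.
have v0 : 0 < v by rewrite divr_gt0 // !mulr_gt0.
apply: sym_lim_ge; first exact: sym_cvg_kim cw v0.
have [M0 hM] := sym_range_cover B; exists M0 => M MM.
have rco : 0 < r * co by rewrite mulr_gt0 //; lra.
have rsi : r * si <= r * co by rewrite ler_pM2l //; lra.
have uE : - u = T%:R * ((1 + r * co) / polarE r co) by rewrite /u opprK -mulrA.
have vE : v = T%:R * ((r * si) / polarE r co) by rewrite /v /polar_v -!mulrA.
have uTE : u + T%:R = T%:R * ((r ^+ 2 + r * co) / polarE r co).
  by rewrite -[u]opprK uE; move: E0; rewrite /polarE => E0; field; rewrite lt0r_neq0.
have rsr : 0 <= r * si * r by rewrite !mulr_ge0 // ltW.
have r2co : 0 < r ^+ 2 + r * co by rewrite addr_gt0 // exprn_gt0.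
have rr : r * si <= 2 * si * (r ^+ 2 + r * co).
  have : r * si * 1 <= r * si * (2 * co) by rewrite ler_pM2l ?mulr_gt0 //; lra.
  by have := mulr_ge0 (ltW s0) (sqr_ge0 r); lra.
apply: (im_sum_inner cw wd (sym_range_uniq M) (hM M MM) _ _ l01 l0v uvB s0 sg s12).
- by rewrite -subr_gt0 opprK uTE mulr_gt0 // divr_gt0.
- rewrite -[u]opprK uE vE addrC -mulrBr -mulrBl pmulr_rlt0 // pmulr_llt0 ?invr_gt0 //.
  lra.
- rewrite uE vE [leRHS]mulrCA ler_pM2l // [leRHS]mulrA ler_pM2r ?invr_gt0 //.
  have : 2 * si * (r * co) = si * r * (2 * co) by ring.
  have : r * si * 1 <= r * si * (2 * co) by rewrite ler_pM2l ?mulr_gt0 //; lra.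
  lra.
by rewrite uTE vE [leRHS]mulrCA ler_pM2l // [leRHS]mulrA ler_pM2r ?invr_gt0.
Qed.

Lemma polar_im_neg (R : realType) (T : nat) (c : int -> R) (g l0 B r co si : R) :
  let u := polar_u T%:R r co in let v := polar_v T%:R r co si in
  signed_weight T c -> window_dense T c g l0 B -> (0 < T)%N ->
  co ^+ 2 + si ^+ 2 = 1 -> 0 < r -> 0 < si -> 32 * si <= g -> co <= - (1 / 2) ->
  l0 <= v -> `|u| + v <= B -> `|- T%:R - u| + v <= B - T%:R ->
  sym_lim (fun j => c j * kim u v j) <= - (g / 10).
Proof.
move=> u v cw wd T0 cs r0 s0 sg co2 l0v uvB uvB'.
have t0 : 0 < T%:R :> R by rewrite ltr0n.
have E0 := polarE_gt0 cs r0 s0.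
have v0 : 0 < v by rewrite divr_gt0 // !mulr_gt0.
apply: sym_lim_le; first exact: sym_cvg_kim cw v0.
have [M0 hM] := sym_range_cover B; exists M0 => M MM.
have [r1|r1] := leP 1 r.
  exact: (im_sum_outer cw wd (sym_range_uniq M) (hM M MM) T0 cs r1 s0 co2 l0v uvB sg).
pose s := [seq - T%:Z - i | i <- sym_range M].
have us : uniq s by rewrite map_inj_uniq ?sym_range_uniq //; exact: mirror_inj.
have ri1 : 1 <= r^-1 by rewrite invf_ge1 // ltW.
have u'E : polar_u T%:R r^-1 co = - T%:R - u by rewrite polar_u_inv ?lt0r_neq0.
have v'E : polar_v T%:R r^-1 co si = v by rewrite polar_v_inv ?lt0r_neq0.
rewrite (eq_bigr (fun j => mirror T c (- T%:Z - j) * kim (- T%:R - u) v (- T%:Z - j))); last first.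
  by move=> j _; rewrite /mirror mirrorK mirror_kim.
rewrite -(mirror_sum T _ xpredT (fun j => mirror T c j * kim (- T%:R - u) v j)).
rewrite -u'E -v'E.
apply: (im_sum_outer (mirror_signed cw) (mirror_window_dense wd) us) => //.
- move=> j jB; apply/mapP; exists (- T%:Z - j); last by rewrite mirrorK.
  apply: hM => //.
  have -> : (- T%:Z - j)%:~R = - T%:R - j%:~R :> R by rewrite rmorphB rmorphN.
  apply: (le_trans (ler_normB _ _)); rewrite normrN (gtr0_norm t0).
  by move: jB; lra.
- by rewrite v'E.
by rewrite u'E v'E.
Qed.

Lemma root_exists (R : realType) (T : nat -> nat) (A : R -> R -> R)
    (Nmin : R -> R -> nat) (a : configuration) (N n : nat) (g l : R) :
  let t : R := (T N)%:R in let s1 := g / 32 in let la := 3 / s1 in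
  let K := 2 ^+ n.+2 * la + 6 in let y0 := s1 / (4 * K) in
  let c := pole_weight R a (T N) N in
  increasing_configuration a -> assumption2 T A Nmin a -> (0 < N)%N ->
  (Nmin 4%R 1%R <= N)%N -> (0 < T N)%N -> 0 < g -> g <= 1 ->
  window_dense (T N) c g (t * y0) (t * (2 / s1 + 2)) -> 1 <= t * y0 ->
  `|l| <= n%:R * g / 10 - la - 23 - A 4 1 ->
  exists x y : R, [/\ `|x| <= s1^-1, y0 <= y <= s1^-1,
    sym_lim (fun j => c j * kre (t * x) (t * y) j) = l &
    sym_lim (fun j => c j * kim (t * x) (t * y) j) = 0].
Proof.
move=> t s1 la K y0 c ia A2 N0 NN T0 g0 g1 wd ty hn.
have t0 : 0 < t by rewrite ltr0n.
have s10 : 0 < s1 by rewrite divr_gt0.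
have s11 : s1 <= 1 / 32 by rewrite /s1; lra.
have la0 : 0 < la by rewrite divr_gt0.
have la1 : 1 <= la by rewrite /la ler_pdivlMr //; lra.
have p0 : 0 < 2 ^+ n.+2 * la by rewrite mulr_gt0 // exprn_gt0.
have K6 : 6 <= K by rewrite /K; lra.
have K0 : 0 < K by lra.
have cw : signed_weight (T N) c by exact: pole_weight_signed.
(* The cosine of the angle with sine [s1]: on [-c1, c1] the sine is at least [s1], with equality at
   both ends. *)
pose c1 := sine_of s1.
have [c1s c10] : s1 ^+ 2 + c1 ^+ 2 = 1 /\ 0 < c1 by apply: sine_ofP; lra.
have s12 : s1 * s1 <= 1 / 32 * (1 / 32) by rewrite ler_pM //; lra.
have c1lt : c1 < 1.
  by rewrite -(ltr_pXn2r (n := 2)) ?nnegrE ?(ltW c10) // expr1n; have := exprn_gt0 2 s10; lra.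
have c1h : 1 / 2 <= c1.
  rewrite -(ler_pXn2r (n := 2)) ?nnegrE ?(ltW c10) // expr_div_n expr1n.
  by rewrite expr2 in c1s; lra.
have sc1 : sine_of c1 = s1.
  by rewrite /sine_of -c1s addrK sqrtr_sqr ger0_norm // ltW.
have scN : sine_of (- c1) = s1 by rewrite -sc1 /sine_of sqrrN.
have inI (x : R) : - c1 <= x <= c1 -> -1 < x < 1 by lra.
have sine_ge (x : R) : - c1 <= x <= c1 -> s1 <= sine_of x.
  move=> xI; have [cs s0] := sine_ofP (inI x xI).
  rewrite -(ler_pXn2r (n := 2)) ?nnegrE ?(ltW s0) ?(ltW s10) //.
  have : x ^+ 2 <= c1 ^+ 2.
    by rewrite -[leLHS]real_normK ?num_real // lerXn2r ?nnegrE ?(ltW c10) // ler_norml.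
  lra.
pose U := polar_u t; pose V r x := polar_v t r x (sine_of x).
have bnd (r x : R) : K^-1 <= r <= K -> - c1 <= x <= c1 ->
    [/\ t * y0 <= V r x, V r x <= t * s1^-1 & `|U r x| <= t * s1^-1].
  move=> rI xI; have [cs s0] := sine_ofP (inI x xI).
  by apply: polar_bounds => //; [exact: sine_ge|lra].
have rpos r : K^-1 <= r <= K -> 0 < r.
  by move=> /andP[h _]; rewrite (lt_le_trans _ h) // invr_gt0.
have inv_in r : K^-1 <= r <= K -> K^-1 <= r^-1 <= K.
  move=> rI; have r0 := rpos r rI; case/andP: rI => h1 h2.
  by rewrite lef_pV2 ?posrE // h2 /= -[K]invrK lef_pV2 ?posrE ?invr_gt0.
have Uinv (r x : R) : K^-1 <= r <= K -> - c1 <= x <= c1 ->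
    U r^-1 x = - t - U r x /\ V r^-1 x = V r x.
  move=> rI xI; have r0 := rpos r rI; have [cs s0] := sine_ofP (inI x xI).
  have E0 := polarE_gt0 cs r0 s0.
  by rewrite /U /V polar_u_inv ?polar_v_inv ?lt0r_neq0.
have s1i : 2 / s1 = s1^-1 + s1^-1 by ring.
have B1 (r x : R) : K^-1 <= r <= K -> - c1 <= x <= c1 ->
    `|U r x| + V r x <= t * (2 / s1 + 2) /\
    `|- t - U r x| + V r x <= t * (2 / s1 + 2) - t.
  move=> rI xI; have [b1 b2 b3] := bnd r x rI xI.
  have [b1' b2' b3'] := bnd _ x (inv_in r rI) xI.
  have [e1 e2] := Uinv r x rI xI; rewrite e1 in b3'.
  by rewrite s1i; lra.
have V0 (r x : R) : K^-1 <= r <= K -> - c1 <= x <= c1 -> 0 < V r x.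
  by move=> rI xI; have [b1 _ _] := bnd r x rI xI; lra.
pose im r x := sym_lim (fun j => c j * kim (U r x) (V r x) j).
pose re r x := sym_lim (fun j => c j * kre (U r x) (V r x) j).
pose f r x := im r x / (t * r * sine_of x).
have kpos (r x : R) : K^-1 <= r <= K -> - c1 <= x <= c1 -> 0 < t * r * sine_of x.
  move=> rI xI; apply: mulr_gt0; first by rewrite mulr_gt0 // rpos.
  exact: lt_le_trans s10 (sine_ge x xI).
have Kin : K^-1 <= K <= K.
  by rewrite lexx andbT (@le_trans _ _ 1) // ?invf_le1 //; clear -K6; lra.
have Kin' : K^-1 <= K^-1 <= K by rewrite lexx; case/andP: Kin.
have cpol (r x : R) : K^-1 <= r <= K -> - c1 <= x <= c1 ->
    (fun p : R * R => (U p.1 p.2, V p.1 p.2)) @ (r, x) --> (U r x, V r x).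
  by move=> rI xI; exact: cvg_polar (rpos r rI) (inI x xI).
have cre (r x : R) : K^-1 <= r <= K -> - c1 <= x <= c1 ->
    (fun p : R * R => re p.1 p.2) @ (r, x) --> re r x.
  move=> rI xI; exact: (cvg_comp _ (fun p : R * R => sym_lim (fun j => c j * kre p.1 p.2 j))
    (cpol r x rI xI) (cvg_sym_lim_kre cw (V0 r x rI xI))).
have cim (r x : R) : K^-1 <= r <= K -> - c1 <= x <= c1 ->
    (fun p : R * R => im p.1 p.2) @ (r, x) --> im r x.
  move=> rI xI; exact: (cvg_comp _ (fun p : R * R => sym_lim (fun j => c j * kim p.1 p.2 j))
    (cpol r x rI xI) (cvg_sym_lim_kim cw (V0 r x rI xI))).
have csine (x : R) : - c1 <= x <= c1 -> (fun y : R => sine_of y) @ x --> sine_of x.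
  move=> xI.
  have cc : (fun y : R => 1 - y ^+ 2) @ x --> 1 - x ^+ 2.
    exact: (cvgB (cvg_cst (1 : R)) (cvgM cvg_id cvg_id)).
  exact: (cvg_comp _ (@Num.sqrt R) cc (@sqrt_continuous R _)).
have cf (r x : R) : K^-1 <= r <= K -> - c1 <= x <= c1 ->
    (fun p : R * R => f p.1 p.2) @ (r, x) --> f r x.
  move=> rI xI; apply: cvgM; first exact: cim.
  apply: cvgV; first by rewrite lt0r_neq0 ?kpos.
  apply: cvgM; first by apply: cvgM; [exact: cvg_cst|exact: cvg_fst].
  exact: (cvg_comp _ _ (@cvg_snd _ _ (nbhs r) (nbhs x) _) (csine x xI)).
have c1I : - c1 <= c1 <= c1 by lra.
have c1I' : - c1 <= - c1 <= c1 by lra.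
have [|||||||r [x [rI xI f0 re0]]] :=
  @ivt_two_variables R f (fun r x => re r x - l) K^-1 K (- c1) c1.
- by case/andP: Kin.
- lra.
- exact: cf.
- by move=> r x rI xI; apply: cvgB; [exact: cre|exact: cvg_cst].
- move=> r x x' rI h1 h2 h3.
  by apply: polar_im_increasing => //; [exact: rpos|clear -h1 c1lt; lra|clear -h3 c1lt; lra].
- move=> r rI; have r0 := rpos r rI.
  have [p1 p2] := B1 r _ rI c1I; have [n1 n2] := B1 r _ rI c1I'.
  have [b1 _ _] := bnd r _ rI c1I; have [b1' _ _] := bnd r _ rI c1I'.
  have [q1 q2] : c1 ^+ 2 + s1 ^+ 2 = 1 /\ (- c1) ^+ 2 + s1 ^+ 2 = 1.
    by rewrite sqrrN addrC.
  rewrite /V sc1 in p1 p2 b1; rewrite /V scN in n1 n2 b1'.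
  have g32 : 32 * s1 <= g by rewrite /s1; clear; lra.
  have ip : g / 4 <= im r c1.
    rewrite /im /V sc1.
    by apply: (polar_im_pos cw wd T0 q1 r0 s10 g32 _ c1h ty b1 p1); clear -s11; lra.
  have iN : im r (- c1) <= - (g / 10).
    rewrite /im /V scN.
    by apply: (polar_im_neg cw wd T0 q2 r0 s10 g32 _ b1' n1 n2); clear -c1h; lra.
  rewrite /f pmulr_llt0 ?invr_gt0 ?kpos // pmulr_lgt0 ?invr_gt0 ?kpos //.
  clear -ip iN g0; lra.
- move=> x xI; have [cs s0] := sine_ofP (inI x xI).
  have [e1 e2 e3] := polar_end_bounds t0 s10 (sine_ge x xI) cs K6.
  have [b1 _ _] := bnd K x Kin xI; have [u1 u2] := Uinv K x Kin xI.
  have v1 : 1 <= V K x by exact: le_trans b1.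
  have vt : V K x <= t.
    apply: (le_trans e3); rewrite ler_pdivrMr // mulrC ler_pM2l //; clear -K6; lra.
  have nT : 2 ^+ n.+1 * (la * V K x) < t.
    have h1 : 2 ^+ n.+1 * la * V K x <= 2 ^+ n.+1 * la * (2 * t / K).
      by rewrite ler_pM2l // mulr_gt0 // exprn_gt0.
    rewrite mulrA (le_lt_trans h1) // mulrA ltr_pdivrMr //.
    have -> : 2 ^+ n.+1 * la * (2 * t) = t * (2 ^+ n.+2 * la).
      by rewrite [2 ^+ n.+2]exprS; ring.
    by rewrite ltr_pM2l // ltrDl.
  have tB : 2 * t <= t * (2 / s1 + 2).
    by rewrite mulrDr [t * 2]mulrC lerDr mulr_ge0 ?divr_ge0 // ltW.
  move: hn; rewrite ler_norml => /andP[hl1 hl2].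
  have tB' : t <= t * (2 / s1 + 2) by apply: le_trans tB; clear -t0; lra.
  have hr := re_right_end ia A2 N0 NN T0 wd tB' g0 v1 b1 la1 e1 e2 vt nT.
  have hl : n%:R * g / 10 - la - 23 - A 4 1 <= - re K^-1 x.
    rewrite /re u1 u2.
    by apply: (re_left_end ia A2 N0 NN T0 wd tB g0 v1 b1 la1 _ _ vt nT);
      rewrite -/t opprB addrC subrK.
  by rewrite -/(re K x) in hr; clear -hr hl hl1 hl2; lra.
have [b1 b2 b3] := bnd r x rI xI.
have tn0 : t != 0 by rewrite lt0r_neq0.
have uE : t * (U r x / t) = U r x by rewrite mulrC divfK.
have vE : t * (V r x / t) = V r x by rewrite mulrC divfK.
exists (U r x / t), (V r x / t); rewrite uE vE; split.
- by rewrite normrM normfV (gtr0_norm t0) ler_pdivrMr // mulrC.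
- by rewrite ler_pdivlMr // ler_pdivrMr // mulrC b1 mulrC.
- by move/eqP: re0; rewrite subr_eq0 => /eqP.
by move/eqP: f0; rewrite /f mulf_eq0 invr_eq0 (gt_eqF (kpos r x rI xI)) orbF => /eqP.
Qed.

(** * Choice of the constants and conclusion *)

Lemma negligible_wrt_le (R : realType) (A B : nat -> R) (e : R) :
  negligible_wrt A B -> 0 < e -> (forall N, (0 < N)%N -> 0 < B N) ->
  exists N0 : nat, forall N, (N0 < N)%N -> A N <= e * B N.
Proof.
move=> /cvgrPdist_le/(_ e) h e0 B0; have [N0 _ {}h] := h e0.
exists N0 => N NN; have := h N (ltnW NN).
have BN : 0 < B N by apply: B0; exact: leq_ltn_trans NN.
by rewrite sub0r normrN ler_norml => /andP[_]; rewrite ler_pdivrMr.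
Qed.

Lemma compact_box (R : realType) (x0 x1 y0 y1 : R) :
  compact [set z : R[i]^o | x0 <= complex.Re z <= x1 /\ y0 <= complex.Im z <= y1].
Proof.
have -> : [set z : R[i]^o | x0 <= complex.Re z <= x1 /\ y0 <= complex.Im z <= y1] =
    (fun p : R * R => (p.1 +i* p.2 : R[i]^o)) @` (`[x0, x1] `*` `[y0, y1]).
  apply/seteqP; split => [[x y] /= [hx hy]|_ [[x y] [/= hx hy] <-]] /=.
    by exists (x, y) => //=; rewrite !in_itv.
  by rewrite !in_itv /= in hx hy.
apply: continuous_compact; last by apply: compact_setX; exact: segment_compact.
apply: continuous_subspaceT => -[x y].
by apply: cvg_complex; [exact: cvg_fst|exact: cvg_snd].
Qed.

Unset Implicit Arguments.
Set Strict Implicit.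

Theorem proposition2p6 (R : realType) (beta : R) (T : nat -> nat)
    (D Q : nat -> R) (rlo rup : R) (A : R -> R -> R) (Nmin : R -> R -> nat)
    (beta01 : 0 < beta < 1)
    (T_gt0 : forall N : nat, (0 < N)%N -> (0 < T N)%N)
    (T_oo : T @ \oo --> \oo)
    (T_small : negligible_wrt (fun N => (T N)%:R : R) (fun N => N%:R))
    (density : density_data T D Q rlo rup)
    (A_gt0 : forall R0 delta : R, 0 < R0 -> 0 < delta -> 0 < A R0 delta) :
  exists (N0 : nat) (Z : set R[i]^o),
    [/\ compact Z,
        Z `<=` @upper_half_plane R
      & forall a : configuration,
          increasing_configuration a ->
          assumption1 D Q rlo rup a ->
          assumption2 T A Nmin a ->
          forall N : nat, (N0 < N)%N ->
            exists zc : R[i], unique (upper_root beta T a N) zc /\ Z zc].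
Proof.
have [DQ0 DT TQ _ [rlo0 /andP[rlu rup1]]] := density.
pose g := Num.min rlo (1 - rup) / 4.
have [g0 g1 grlo grup] : [/\ 0 < g, g <= 1, 4 * g <= rlo & 2 * g <= 1 - rup].
  by rewrite /g minEle; split; case: ifP; lra.
pose l := ln (beta^-1 - 1).
pose s1 := g / 32; pose la := 3 / s1.
have s10 : 0 < s1 by rewrite divr_gt0.
have la0 : 0 < la by rewrite divr_gt0.
pose n := (Num.truncn (10 * (`|l| + la + 23 + A 4 1) / g)).+1.
have hn : `|l| <= n%:R * g / 10 - la - 23 - A 4 1.
  have : 10 * (`|l| + la + 23 + A 4 1) / g < n%:R by exact: truncnS_gt.
  by rewrite ltr_pdivrMr //; lra.
pose K := 2 ^+ n.+2 * la + 6; pose y0 := s1 / (4 * K).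
have K6 : 6 <= K by rewrite /K lerDr mulr_ge0 ?exprn_ge0 // ltW.
have y00 : 0 < y0 by rewrite divr_gt0 // mulr_gt0; lra.
(* With [D <= e T] and [1 <= e T], both [4 D <= y0 T] and [2 (1 + D) <= (1 - rup) y0 T] follow, so
   windows of length [y0 T] are long enough. *)
pose e := Num.min 1 ((1 - rup) * y0 / 4).
have [e0 e1 e2 e3] : [/\ 0 < e, e <= 1, 4 * e <= (1 - rup) * y0 & 4 * e <= y0].
  have h : 0 < (1 - rup) * y0 by rewrite mulr_gt0 //; lra.
  have h' : (1 - rup) * y0 <= 1 * y0 by rewrite ler_pM2r //; lra.
  by clear -y00 h h'; rewrite /e minEle; split; case: ifP; lra.
have tpos N : (0 < N)%N -> 0 < (T N)%:R :> R by move=> /T_gt0; rewrite ltr0n.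
have [N1 h1] := negligible_wrt_le DT e0 tpos.
(* One unit more than the window radius divided by T, to leave room for the overshoot [D <= T]. *)
pose B := 2 / s1 + 3.
have B0 : 0 < B by rewrite addr_gt0 // divr_gt0.
have Bi : 0 < B^-1 by rewrite invr_gt0.
have [N2 h2] := negligible_wrt_le TQ Bi (fun N N0 => (DQ0 N N0).2).
have [N3 _ h3] : \forall N \near \oo, (Num.truncn e^-1 < T N)%N.
  exact: (T_oo _ (nbhs_infty_gt (Num.truncn e^-1))).
exists (N1 + N2 + N3 + Nmin 4%R 1%R)%N.
exists [set z : R[i]^o | - s1^-1 <= complex.Re z <= s1^-1 /\
                         y0 <= complex.Im z <= s1^-1].
split; first exact: compact_box.
  by move=> z [_ /andP[h _]]; exact: lt_le_trans h.
move=> a ia A1 A2 N NN.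
have N0 : (0 < N)%N by exact: leq_ltn_trans NN.
have [D0 Q0] := DQ0 N N0; have T0 := T_gt0 N N0; have t0 := tpos N N0.
have {}h1 : D N <= e * (T N)%:R by apply: h1; move: NN; clear; lia.
have {}h2 : (T N)%:R * B <= Q N.
  rewrite mulrC -ler_pdivlMl //; apply: h2; move: NN; clear; lia.
have {}h3 : 1 <= e * (T N)%:R.
  have {}h3 : (Num.truncn e^-1 < T N)%N by apply: h3 => /=; move: NN; clear; lia.
  rewrite -ler_pdivrMl // mulr1 ltW // (lt_le_trans (truncnS_gt _)) //.
  by rewrite ler_nat.
have NN4 : (Nmin 4%R 1%R <= N)%N by move: NN; clear; lia.
have et1 : e * (T N)%:R <= (T N)%:R by rewrite ler_piMl // ltW.
have et2 : 4 * e * (T N)%:R <= (1 - rup) * y0 * (T N)%:R by rewrite ler_pM2r.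
have et3 : 4 * e * (T N)%:R <= y0 * (T N)%:R by rewrite ler_pM2r.
have wd : window_dense (T N) (pole_weight R a (T N) N) g ((T N)%:R * y0)
    ((T N)%:R * (2 / s1 + 2)).
  refine (@pole_weight_window_dense R D Q rlo rup a (T N) N g _ _ ia A1 N0 D0 rlo0 _
    grlo grup _ _ _).
  - by rewrite rlu.
  - by lra.
  - by lra.
  - by move: h2; rewrite /B; lra.
have ty : 1 <= (T N)%:R * y0 by clear -h3 et3 t0 e0; lra.
have [x [y [hx hy re0 im0]]] := @root_exists R T A Nmin a N n g l ia A2 N0 NN4 T0 g0 g1 wd
  ty hn.
have y_gt0 : 0 < y by case/andP: hy => h _; exact: lt_le_trans h.
exists (x +i* y); split; last by split; rewrite //= -ler_norml.
split.
  split=> //; rewrite S'_kernels // re0 im0 oppr0 subrr //.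
move=> [x' y'] [/= y'_gt0].
rewrite S'_kernels // => -[/eqP + /eqP]; rewrite subr_eq0 oppr_eq0 => /eqP re0' /eqP im0'.
have [] := pole_sum_root_unique (pole_weight_signed R a (T N) N)
  (mulr_gt0 t0 y_gt0) (mulr_gt0 t0 y'_gt0) re0 im0 re0' im0'.
by move=> /(mulfI (lt0r_neq0 t0)) -> /(mulfI (lt0r_neq0 t0)) ->.
Qed.
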